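(* Let $\mu,\nu\in\mathcal P_2(\mathbb R^d)$ with $\mu$ dominated by $\nu$ in convex order. Then $$\inf_{m\in \mathsf{MT}(\mu,\nu)} H(m\mid\mu\otimes\nu)=\sup_{\bar\mu\in\mathcal P_2(\mathbb R^d)}\left\{\inf_{\pi\in\mathsf{Cpl}(\bar\mu,\nu)}\left[H(\pi\mid\bar\mu\otimes\nu)-\int\bar x\cdot y\,\pi(d\bar x,dy)\right]+\mathrm{MCov}(\bar\mu,\mu)\right\}.$$
   Context: $\mathcal P_2(\mathbb R^d)$ is the set of Borel probability measures on $\mathbb R^d$ with finite second moment. Convex order: $\int\phi\,d\mu\le\int\phi\,d\nu$ for all convex $\phi:\mathbb R^d\to\mathbb R$. $\mathsf{Cpl}(\alpha,\beta)$ is the set of couplings of $\alpha$ and $\beta$ (probability measures on $\mathbb R^d\times\mathbb R^d$ with first marginal $\alpha$ and second marginal $\beta$). $\mathsf{MT}(\mu,\nu)\subset\mathsf{Cpl}(\mu,\nu)$ is the subset of martingale couplings $m(dx,dy)=\mu(dx)m_x(dy)$, i.e. with $\int y\,m_x(dy)=x$ for $\mu$-a.e. $x$. $H(Q\mid R)=\int\log\frac{dQ}{dR}\,dQ$ if $Q\ll R$ and $+\infty$ otherwise. $\mathrm{MCov}(\bar\mu,\mu)=\sup_{\pi\in\mathsf{Cpl}(\bar\mu,\mu)}\int\bar x\cdot x\,\pi(d\bar x,dx)$. *)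

(* Defs.v *)
From HB Require Import structures.
From mathcomp Require Import all_boot all_order all_algebra.
From mathcomp Require Import all_classical all_reals all_analysis.

Set Implicit Arguments.
Unset Strict Implicit.
Unset Printing Implicit Defensive.

Import Order.TTheory GRing.Theory Num.Theory.
Import numFieldNormedType.Exports.

Local Open Scope classical_set_scope.
Local Open Scope ring_scope.
Local Open Scope ereal_scope.
Local Open Scope charge_scope.

(* Row vectors with the Borel sigma-algebra, i.e. the one generated by the
   open sets of 'rV[R]_d. *)
Definition Rd (R : realType) (d : nat) :
    measurableType (@open 'rV[R]_d).-sigma%mdisp :=
  g_sigma_algebraType (@open 'rV[R]_d).

Definition dotv (R : realType) (d : nat) (x y : 'rV[R]_d) : R :=
  (\sum_(i < d) x ord0 i * y ord0 i)%R.

Definition P2 (R : realType) (d : nat) : set (probability (Rd R d) R) :=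
  [set mu : probability (Rd R d) R | \int[mu]_x (dotv x x)%:E < +oo].

(* For mu, nu in P2 the negative parts of both integrals are finite (a convex
   function has an affine minorant), so the integrals exist, possibly +oo. *)
Definition convex_order (R : realType) (d : nat)
    (mu nu : probability (Rd R d) R) : Prop :=
  forall phi : 'rV[R]_d -> R,
    convex_function (setT : set (convex_lmodType 'rV[R]_d)) phi ->
    \int[mu]_x (phi x)%:E <= \int[nu]_x (phi x)%:E.

Definition Cpl (R : realType) (d : nat) (alpha beta : probability (Rd R d) R) :
    set (probability (Rd R d * Rd R d)%type R) :=
  [set pi | (forall A, measurable A -> pi (fst @^-1` A) = alpha A) /\
            (forall B, measurable B -> pi (snd @^-1` B) = beta B)].

(* m(dx, dy) = mu(dx) k_x(dy) *)
Definition disintegrates (R : realType) (d : nat)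
    (m : probability (Rd R d * Rd R d)%type R) (mu : probability (Rd R d) R)
    (k : R.-pker (Rd R d) ~> (Rd R d)) : Prop :=
  forall C, measurable C -> m C = \int[mu]_x k x (xsection C x).

(* The value of an integral is finite only if the integrand is integrable, so
   the barycenter equation includes the integrability of the coordinates. *)
Definition MT (R : realType) (d : nat) (mu nu : probability (Rd R d) R) :
    set (probability (Rd R d * Rd R d)%type R) :=
  [set m | Cpl mu nu m /\
    exists2 k : R.-pker (Rd R d) ~> (Rd R d), disintegrates m mu k &
      {ae mu, forall x : 'rV[R]_d, forall i : 'I_d,
        \int[k x]_y ((y : 'rV[R]_d) ord0 i)%:E = (x ord0 i)%:E}].

Definition rel_entropy (R : realType) (disp : measure_display)
    (T : measurableType disp) (Q P : probability T R) : \bar R :=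
  if `[< Q `<< P >]
  then \int[Q]_z lne (('d (charge_of_finite_measure Q) '/d P) z)
  else +oo.

Definition MCov (R : realType) (d : nat) (mub mu : probability (Rd R d) R) :
    \bar R :=
  ereal_sup [set \int[pi]_z (dotv z.1 z.2)%:E | pi in Cpl mub mu].

(* Main.v *)
(* With densities f of couplings relative to mu x nu, both sides become convex
   problems: the martingale constraint is the linear equation B f = id, where
   B f (x) = \int y f(x, y) nu(dy), and the entropy is the integral of
   t ln t - t + 1 evaluated at f.

   For the inequality <=, let f_n minimize entropy + n |id - B f|^2, with the
   L^2(mu) norm. First-order optimality makes the law of 2 n (id - B f_n) under
   mu a competitor in the supremum whose value is at least the penalized
   minimum. If the supremum is finite, these minima stay bounded, and their
   limit yields a martingale coupling. Minimizers and limits exist because the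
   midpoint convexity defect of the entropy controls a weighted L^1 distance:
   almost minimizing sequences are Cauchy, and the weight sqrt (1 + |y|^2),
   allowed by the second moment of nu, lets barycenters pass to the limit.

   For >=, glue a martingale coupling with a coupling of mub and mu and apply
   the data processing inequality. *)
From HB Require Import structures.
Require Import Defs.
From mathcomp Require Import all_boot all_order all_algebra.
From mathcomp Require Import all_classical all_reals all_analysis.
From mathcomp Require Import measurable_realfun ring lra.

Set Implicit Arguments.
Unset Strict Implicit.
Unset Printing Implicit Defensive.

Import Order.TTheory GRing.Theory Num.Theory.
Import numFieldNormedType.Exports.

Local Open Scope classical_set_scope.
Local Open Scope ring_scope.
Local Open Scope ereal_scope.

(** * Lower limits and the entropy integrand *)

(** Neither weak compactness nor a minimax theorem enters: quantitative strict convexity does their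
    work. The midpoint of two almost minimizers is itself a competitor, so the convexity defect of
    the entropy between them is at most a multiple of their excess. Excesses [4^-k] give weighted
    L^1 increments of order [2^-k], and the sum of the increments dominates the whole sequence. One
    limit lemma, stated for a nondecreasing family of penalties, then serves twice: a constant
    family yields a minimizer at fixed strength, the strengths [n] yield the martingale limit.

    The factor in [2 n (id - B f_n)] comes from differentiating the penalty in the barycenter. With
    [r = id - B f_n], optimality bounds the dual functional below by the entropy of [f_n] plus
    [2 n |r|^2], which exceeds the penalized minimum by [n |r|^2]; an inequality is all that is
    needed. No optimal transport is solved either: the joint law of the dual variable and the
    identity under [mu] is one coupling, and it bounds [MCov] from below. *)

Section limn_einf.
Context {R : realType}.
Implicit Types u v : (\bar R)^nat.

Lemma le_limn_einf u v : (\forall n \near \oo, u n <= v n) ->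
  limn_einf u <= limn_einf v.
Proof.
move=> [k _ uv]; rewrite !limn_einf_lim; apply: lee_lim; [exact: is_cvg_einfs..|].
near=> n; apply: le_ereal_inf_tmp => _ [p /= np] <-.
have kp : (k <= p)%N by apply: leq_trans np; near: n; exact: nbhs_infty_ge.
by apply: le_trans (uv p kp); apply: ereal_inf_lbound; exists p.
Unshelve. all: by end_near. Qed.

Lemma limn_einf_ge0 u : (forall n, 0 <= u n) -> 0 <= limn_einf u.
Proof.
move=> u0; apply: (@le_trans _ _ (limn_einf (cst 0 : (\bar R)^nat))).
  by rewrite (cvg_limn_einf_sup (cvg_cst _)).1.
by apply: le_limn_einf; exact: nearW.
Qed.

Lemma ge0_limn_einfD u v : (forall n, 0 <= u n) -> (forall n, 0 <= v n) ->
  limn_einf u + limn_einf v <= limn_einf (fun n => u n + v n).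
Proof.
move=> u0 v0.
have einf0 (w : (\bar R)^nat) : (forall n, 0 <= w n) -> limn (einfs w) \in [pred x | 0 <= x].
  by move=> w0; have := limn_einf_ge0 w0; rewrite limn_einf_lim.
have uv : limn (einfs u) +? limn (einfs v) by apply: ge0_adde_def; exact: einf0.
rewrite !limn_einf_lim -limeD//; [|exact: is_cvg_einfs..].
apply: lee_lim; [|exact: is_cvg_einfs|].
  by apply: is_cvgeD => //; exact: is_cvg_einfs.
apply: nearW => n; apply: le_ereal_inf_tmp => _ [p /= np] <-.
by apply: leeD; apply: ereal_inf_lbound; exists p.
Qed.

Lemma limn_einfZl (c : R) u : (0 <= c)%R ->
  c%:E * limn_einf u <= limn_einf (fun n => c%:E * u n).
Proof.
move=> c0; rewrite !limn_einf_lim -limeMl//; last exact: is_cvg_einfs.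
apply: lee_lim; [|exact: is_cvg_einfs|].
  by apply: is_cvgeZl => //; exact: is_cvg_einfs.
apply: nearW => n; apply: le_ereal_inf_tmp => _ [p /= np] <-.
by apply: lee_wpmul2l; [rewrite lee_fin|apply: ereal_inf_lbound; exists p].
Qed.

End limn_einf.

Section kl.
Context {R : realType}.
Local Open Scope ring_scope.
Implicit Types a b m t x y : R.

Lemma ln_le_subr1 x : 0 < x -> ln x <= x - 1.
Proof.
move=> x0; have := @le_ln1Dx R (x - 1).
by rewrite subrKC; apply; lra.
Qed.

(** At [t = 0] the product vanishes whatever default [ln] takes there, so [kl 0 = 1] is the
    continuous extension. *)
Definition kl t : R := t * ln t - t + 1.

(** The left side is the tangent line of [kl] at [m], since the derivative of [kl] is [ln]. It is
    affine in [a], which makes it the source of convexity, lower semicontinuity and data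
    processing. *)
Lemma kl_tangent a m : 0 <= a -> 0 < m -> a * ln m - m + 1 <= kl a.
Proof.
rewrite le_eqVlt => /predU1P[<-|a0] m0; first by rewrite /kl !mul0r; lra.
have : ln (m / a) <= m / a - 1 by apply: ln_le_subr1; rewrite divr_gt0.
rewrite ln_div ?posrE// => h.
have : a * (ln m - ln a) <= a * (m / a - 1) by rewrite ler_pM2l.
by rewrite mulrBr [X in _ <= X]mulrBr mulrCA divff ?gt_eqF// /kl; lra.
Qed.

Lemma kl_ge0 a : 0 <= a -> 0 <= kl a.
Proof. by move=> a0; have := kl_tangent a0 ltr01; rewrite ln1; lra. Qed.

Lemma kl1 : kl 1 = 0. Proof. by rewrite /kl ln1; lra. Qed.

Lemma kl_convex a b t : 0 <= a -> 0 <= b -> 0 <= t <= 1 ->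
  kl ((1 - t) * a + t * b) <= (1 - t) * kl a + t * kl b.
Proof.
move=> a0 b0 /andP[t0 t1].
have : 0 <= (1 - t) * a + t * b by rewrite addr_ge0 ?mulr_ge0// subr_ge0.
set m := _ + _; rewrite le_eqVlt => /predU1P[m0|m0].
  (* There is no tangent at [0]; here both terms of the combination vanish separately. *)
  have : (1 - t) * a + t * b = 0 by rewrite -/m.
  move=> /eqP; rewrite paddr_eq0 ?mulr_ge0 ?subr_ge0// => /andP[/eqP ta /eqP tb].
  rewrite -m0 {1}/kl mul0r /kl !mulrDr !mulrN !(mulrA _ a) !(mulrA _ b) ta tb.
  by lra.
have t1' : 0 <= 1 - t by rewrite subr_ge0.
have := ler_wpM2l t1' (kl_tangent a0 m0).
have := ler_wpM2l t0 (kl_tangent b0 m0).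
have : m * ln m = ((1 - t) * a + t * b) * ln m by [].
by rewrite [X in _ -> _ -> _ -> X <= _]/kl; lra.
Qed.

(* Since [ln x <= x - 1] at [x = sqrt (m / a)], the midpoint convexity defect of
   [kl] dominates half the squared Hellinger distance [(sqrt a - sqrt b) ^ 2];
   the weighted estimate is then AM-GM. *)
Lemma kl_gap a b w e : 0 <= a -> 0 <= b -> 0 < e ->
  w * `|a - b| <=
  (kl a + kl b - 2 * kl ((a + b) / 2)) / e + e * (w ^+ 2 * (a + b)).
Proof.
move=> a0 b0 e0.
pose p := Num.sqrt a; pose q := Num.sqrt b; pose r := Num.sqrt ((a + b) / 2).
have p0 : 0 <= p by rewrite sqrtr_ge0.
have q0 : 0 <= q by rewrite sqrtr_ge0.
have r0 : 0 <= r by rewrite sqrtr_ge0.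
have pE : p ^+ 2 = a by rewrite sqr_sqrtr.
have qE : q ^+ 2 = b by rewrite sqr_sqrtr.
have rE : r ^+ 2 = (a + b) / 2 by rewrite sqr_sqrtr//; lra.
(* [ln_le_subr1] at [y / x], multiplied by [2 x^2]. The lower bound on [y^2] serves only to make [y]
   positive when [x] is. *)
have key (x y : R) : 0 <= x -> 0 <= y -> 0 <= y ^+ 2 - x ^+ 2 / 2 ->
    x ^+ 2 * ln (y ^+ 2) - x ^+ 2 * ln (x ^+ 2) <= 2 * (x * y - x ^+ 2).
  rewrite le_eqVlt => /predU1P[<-|x0] y0; first by rewrite expr0n/= !mul0r; lra.
  move=> yx.
  have {}y0 : 0 < y.
    rewrite lt_neqAle y0 andbT; apply/eqP => y0'; move: yx; rewrite -y0'.
    have x2 : 0 < x ^+ 2 by rewrite exprn_gt0.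
    by rewrite expr0n/=; lra.
  have := ln_le_subr1 (divr_gt0 y0 x0).
  rewrite ln_div ?posrE// !lnXn// => h.
  have : x ^+ 2 * (ln y - ln x) <= x ^+ 2 * (y / x - 1).
    by rewrite ler_pM2l// exprn_gt0.
  rewrite [X in _ <= X -> _]mulrBr mulrA.
  have -> : x ^+ 2 * y / x = x * y by rewrite expr2; field; rewrite gt_eqF.
  by rewrite !mulr2n; lra.
have kp := key p r p0 r0; have kq := key q r q0 r0.
have {}kp := kp ltac:(rewrite pE rE; lra).
have {}kq := kq ltac:(rewrite qE rE; lra).
have gap : (p - q) ^+ 2 / 2 <= kl a + kl b - 2 * kl ((a + b) / 2).
  rewrite /kl -rE -pE -qE.
  have r2 : 2 * r ^+ 2 = p ^+ 2 + q ^+ 2 by rewrite rE pE qE; lra.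
  have : (p ^+ 2 + q ^+ 2) * ln (r ^+ 2) = 2 * r ^+ 2 * ln (r ^+ 2) by rewrite r2.
  suff : (p - q) ^+ 2 / 2 <= 2 * (p ^+ 2 + q ^+ 2 - r * (p + q)) by nra.
  have pqr : p + q <= 2 * r.
    rewrite -(@ler_pXn2r _ 2)// ?nnegrE; [|lra|lra].
    by have := sqr_ge0 (p - q); rewrite exprMn; lra.
  by have := mulr_ge0 r0 (_ : 0 <= 2 * r - (p + q)); nra.
have abE : a - b = (p - q) * (p + q) by rewrite -pE -qE; ring.
rewrite abE normrM (ger0_norm (addr_ge0 p0 q0)).
have s0 := normr_ge0 (p - q).
have s2 : `|p - q| ^+ 2 = (p - q) ^+ 2 by rewrite real_normK// num_real.
have : (kl a + kl b - 2 * kl ((a + b) / 2)) / e >= `|p - q| ^+ 2 / 2 / e.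
  by rewrite ler_pM2r ?invr_gt0// s2.
suff : w * (`|p - q| * (p + q)) <=
    `|p - q| ^+ 2 / 2 / e + e * (w ^+ 2 * (a + b)) by lra.
set s := `|p - q|; rewrite -(ler_pM2r e0) mulrDl divfK ?gt_eqF//.
rewrite -pE -qE.
(* AM-GM bounds [s e w (p + q)] by half of [s^2 + (e w)^2 (p + q)^2], and
   [(p + q)^2 = 2 (p^2 + q^2) - (p - q)^2]. *)
have := sqr_ge0 (s - e * w * (p + q)).
have := mulr_ge0 (sqr_ge0 (e * w)) (sqr_ge0 (p - q)).
by nra.
Qed.

Lemma kl_midpoint a b : 0 <= a -> 0 <= b -> 2 * kl ((a + b) / 2) <= kl a + kl b.
Proof.
by move=> a0 b0; have := kl_gap 0 a0 b0 ltr01; rewrite mul0r; lra.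
Qed.

(** This is the tangent at the truncation of [h] to [[a, b]], read at [h]. Below [a <= 1] the slope
    [ln a] is nonpositive and above [b >= 1] the slope [ln b] is nonnegative, so moving from the
    point of tangency to [h] only raises the value. Fatou's lemma needs this sign. *)
Lemma kl_truncated_tangent_ge0 h a b : 0 <= h -> 0 < a -> a <= 1 -> 1 <= b ->
  0 <= ln (Num.min b (Num.max a h)) * h + (1 - Num.min b (Num.max a h)).
Proof.
move=> h0 a0 a1 b1; have ab : a <= b by exact: le_trans b1.
have [ha|/ltW ah] := leP h a.
  rewrite (min_idPr ab); have := ler_wnM2l (_ : ln a <= 0) ha.
  by rewrite ln_le0// => /(_ isT); have := kl_ge0 (ltW a0); rewrite /kl; lra.
have [hb|/ltW bh] := leP h b; first by have := kl_ge0 h0; rewrite /kl; lra.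
have := ler_wpM2l (ln_ge0 b1) bh; have := kl_ge0 (le_trans ler01 b1).
by rewrite /kl; lra.
Qed.

Lemma measurable_kl : measurable_fun [set: R] kl.
Proof.
apply: measurable_funD => //; apply: measurable_funB => //.
by apply: measurable_funM; [exact: measurable_id|exact: measurable_ln].
Qed.

(** Each tangent line is continuous, so its value at [a] is below the lower limit. For [a > 0] the
    tangent at [a] is enough; at [a = 0] the tangents at small [e] give [1 - e]. *)
Lemma kl_lsc (u : R^nat) a : 0 <= a -> (forall n, 0 <= u n) ->
  u @ \oo --> a -> ((kl a)%:E <= limn_einf (fun n => (kl (u n))%:E))%E.
Proof.
move=> a0 u0 ua.
have low m : 0 < m -> ((a * ln m - m + 1)%:E <= limn_einf (fun n => (kl (u n))%:E))%E.
  move=> m0.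
  have c : ((u n * ln m - m + 1)%:E @[n --> \oo] --> (a * ln m - m + 1)%:E)%E.
    apply: cvg_EFin; first by near=> n.
    by apply: cvgD; [apply: cvgB; [apply: cvgM => //; exact: cvg_cst|exact: cvg_cst]|exact: cvg_cst].
  rewrite -(cvg_limn_einf_sup c).1; apply: le_limn_einf.
  by apply: nearW => n; rewrite lee_fin kl_tangent.
move: a0 low; rewrite le_eqVlt => /predU1P[<-|a0] low; last first.
  by have := low _ a0; rewrite /kl.
apply/lee_subgt0Pr => e e0; have := low _ e0.
by apply: le_trans; rewrite -EFinB lee_fin /kl !mul0r; lra.
Unshelve. all: by end_near. Qed.
End kl.

(** * Measurability of vector-valued maps *)

Section vector_measurability.
Context {R : realType} {d : nat}.
Local Open Scope ring_scope.

Lemma measurable_coord (i : 'I_d) :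
  measurable_fun [set: Rd R d] (fun x => (x : 'rV[R]_d) ord0 i).
Proof.
apply: (measurability _ (RGenOpens.measurableE R)).
move=> /= _ [_ [a [b ->]] <-]; rewrite setTI; apply: sub_sigma_algebra.
by apply: open_comp => [x _|]; [exact: coord_continuous|exact: itv_open].
Qed.

Lemma mx_ballE (c x : 'rV[R]_d) (e : R) : 0 < e ->
  ball c e x <-> forall i, `|c ord0 i - x ord0 i| < e.
Proof.
move=> e0; split=> [[_ +] i|h]; first exact.
by split=> // i j; rewrite (ord1 i); exact: h.
Qed.

(** The sigma-algebra of [Rd] is generated by open sets, not by coordinates. An open set is a
    countable union of rational balls of the sup norm, and the preimage of such a ball is a finite
    intersection of conditions on coordinates. *)
Lemma measurable_rV {disp} {T : measurableType disp} (f : T -> Rd R d) :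
  (forall i : 'I_d, measurable_fun setT (fun t => (f t : 'rV[R]_d) ord0 i)) ->
  measurable_fun setT f.
Proof.
move=> mf; apply: (@measurability _ _ T (Rd R d) setT f (@open 'rV[R]_d)) => // _ [U oU <-]; rewrite setTI.
pose inU (c : 'rV[rat]_d * rat) : Prop :=
  0 < (ratr c.2 : R) /\ ball (map_mx ratr c.1 : 'rV[R]_d) (ratr c.2) `<=` U.
pose B (c : 'rV[rat]_d * rat) : set T :=
  \bigcap_(i in [set: 'I_d])
    [set t | `|ratr (c.1 ord0 i) - (f t : 'rV[R]_d) ord0 i| < ratr c.2].
(* Enumerates the rational balls contained in [U]; other indices contribute the empty set. *)
pose F n := if unpickle n is Some c then if `[< inU c >] then B c else set0
  else set0.
have -> : f @^-1` U = \bigcup_n F n.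
  apply/seteqP; split => [t Ut|t [n _]]; last first.
    rewrite /F; case: unpickle => // c; case: asboolP => // -[c0 cU] Bt.
    by apply: cU; apply/mx_ballE => // i; rewrite mxE; exact: Bt.
  have [e /= e0 eU] : nbhs_ball (f t : 'rV[R]_d) U.
    by apply/nbhs_ballP; exact: open_nbhs_nbhs.
  (* The rational centre lies within [r] of [f t], so the ball of radius [r] stays within [2 r < e]
     of [f t]. *)
  have [r /itvP r0e] : exists r : rat, ratr r \in `]0, (e / 2)[.
    by apply: rat_in_itvoo; rewrite divr_gt0.
  have r0 : 0 < (ratr r : R) by rewrite r0e.
  have /choice[q qP] : forall i : 'I_d, exists q : rat,
      ratr q \in `](f t : 'rV[R]_d) ord0 i - ratr r,
                  (f t : 'rV[R]_d) ord0 i + ratr r[.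
    by move=> i; apply: rat_in_itvoo; rewrite ltrD2l gtrN.
  have qr i : `|ratr (q i) - (f t : 'rV[R]_d) ord0 i| < ratr r.
    by have := qP i; rewrite in_itv/= ltr_norml => /andP[? ?]; apply/andP; split; lra.
  exists (pickle (\row_i q i, r)) => //; rewrite /F pickleK.
  case: asboolP => [_ i _ /=|]; first by rewrite mxE.
  case; split => //= x /mx_ballE => /(_ r0) qx; apply: eU; apply/mx_ballE => // i.
  have := qx i; rewrite !mxE => qxi; have := qr i.
  have : (ratr r : R) < e / 2 by rewrite r0e.
  have := ler_distD (ratr (q i)) ((f t : 'rV[R]_d) ord0 i) (x ord0 i).
  by rewrite (distrC _ (ratr (q i))); lra.
apply: bigcupT_measurable => n; rewrite /F; case: unpickle => // c.
case: asboolP => // _; apply: fin_bigcap_measurable => [|i _]; first exact: finite_finset.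
rewrite -[X in measurable X]setTI.
by apply: measurable_fun_ltr => //; apply: measurableT_comp => //; exact: measurable_funB.
Qed.

Lemma measurable_dotv {disp} {T : measurableType disp} (f g : T -> Rd R d) :
  measurable_fun setT f -> measurable_fun setT g ->
  measurable_fun setT (fun t => dotv (f t) (g t)).
Proof.
move=> mf mg; apply: measurable_sum => i.
by apply: measurable_funM; exact: (measurableT_comp (measurable_coord i)).
Qed.

Implicit Types x y : 'rV[R]_d.

Lemma dotv_ge0 x : 0 <= dotv x x.
Proof. by apply: sumr_ge0 => i _; rewrite -expr2 sqr_ge0. Qed.

Lemma sqr_coord_le_dotv x i : x ord0 i ^+ 2 <= dotv x x.
Proof.
rewrite /dotv (bigD1 i)//= -expr2 lerDl.
by apply: sumr_ge0 => j _; rewrite -expr2 sqr_ge0.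
Qed.

Lemma normr_dotv_le x y : `|dotv x y| <= dotv x x + dotv y y.
Proof.
rewrite /dotv -big_split/= (le_trans (ler_norm_sum _ _ _))//.
apply: ler_sum => i _; have := normr_ge0 (x ord0 i * y ord0 i).
have := sqr_ge0 (x ord0 i - y ord0 i); have := sqr_ge0 (x ord0 i + y ord0 i).
by rewrite ler_norml => ? ? _; apply/andP; split; nra.
Qed.

End vector_measurability.

(** * Densities and relative entropy *)

Section densities.
Context {disp} {T : measurableType disp} {R : realType}.
Implicit Types (P Q : probability T R) (g : T -> R).

(** One real-valued, everywhere nonnegative version is fixed, so that pointwise inequalities for
    [kl] apply at every point. *)
Definition has_density Q P g :=
  [/\ measurable_fun setT g, forall x, (0 <= g x)%R &
      forall A, measurable A -> Q A = \int[P]_(x in A) (g x)%:E].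

Lemma dominatesP Q P :
  Q `<< P <-> forall A, measurable A -> P A = 0 -> Q A = 0.
Proof. exact: null_content_dominatesP. Qed.

Lemma integral_prob_cst P (r : \bar R) : \int[P]_x (cst r x) = r.
Proof. by rewrite integral_cst// -[RHS]mule1; congr (_ * _); exact: probability_setT. Qed.

Lemma has_density_dominates Q P g : has_density Q P g -> Q `<< P.
Proof.
move=> [mg _ Qg]; apply/dominatesP => A mA PA0; rewrite Qg//.
by apply: null_set_integral => //; apply/measurable_EFinP; exact: measurable_funTS.
Qed.

Lemma has_density_int1 Q P g : has_density Q P g -> \int[P]_x (g x)%:E = 1.
Proof. by move=> [_ _ <-//]; rewrite probability_setT. Qed.

Lemma has_density_integrable Q P g : has_density Q P g ->
  P.-integrable setT (EFin \o g).
Proof.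
move=> dg; have [mg g0 _] := dg; apply/integrableP; split.
  exact/measurable_EFinP.
under eq_integral do rewrite /= ger0_norm//.
by rewrite (has_density_int1 dg) ltry.
Qed.

Lemma density_ae_eq_RN Q P g : has_density Q P g ->
  ae_eq P setT (EFin \o g) (Radon_Nikodym_SigmaFinite.f Q P).
Proof.
move=> dg; have dQP := has_density_dominates dg; have [mg g0 Qg] := dg.
apply: integral_ae_eq => //; first exact: has_density_integrable dg.
  exact: measurable_int (Radon_Nikodym_SigmaFinite.f_integrable dQP).
by move=> E _ mE; rewrite -Radon_Nikodym_SigmaFinite.f_integral//= -Qg.
Qed.

Lemma dominates_density Q P : Q `<< P -> exists g, has_density Q P g.
Proof.
move=> QP; pose f := Radon_Nikodym_SigmaFinite.f Q P.
have ffin x : f x \is a fin_num by exact: Radon_Nikodym_SigmaFinite.f_fin_num.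
exists (fine \o f); split.
- apply: measurableT_comp => //.
  exact: measurable_int (Radon_Nikodym_SigmaFinite.f_integrable QP).
- by move=> x; apply: fine_ge0; exact: Radon_Nikodym_SigmaFinite.f_ge0.
- move=> A mA; rewrite (Radon_Nikodym_SigmaFinite.f_integral QP)//.
  by apply: eq_integral => x _ /=; rewrite fineK.
Qed.

Lemma ge0_integral_density Q P g (f : T -> \bar R) : has_density Q P g ->
  measurable_fun setT f -> (forall x, 0 <= f x) ->
  \int[Q]_x f x = \int[P]_x (f x * (g x)%:E).
Proof.
move=> dg mf f0; have dQP := has_density_dominates dg; have [mg g0 _] := dg.
rewrite -(Radon_Nikodym_SigmaFinite.change_of_variables dQP)//.
apply: ae_eq_integral => //.
- apply: emeasurable_funM => //.
  exact: measurable_int (Radon_Nikodym_SigmaFinite.f_integrable dQP).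
- by apply: emeasurable_funM => //; exact/measurable_EFinP.
- by apply: ae_eqe_mul2l; exact/ae_eq_sym/density_ae_eq_RN.
Qed.

Lemma integral_density Q P g (f : T -> R) : has_density Q P g ->
  measurable_fun setT f ->
  \int[Q]_x (f x)%:E = \int[P]_x (f x * g x)%:E.
Proof.
move=> dg mf; have [mg g0 _] := dg.
have mfE : measurable_fun setT (EFin \o f) by exact/measurable_EFinP.
rewrite integralE [RHS]integralE.
congr (_ - _); (rewrite (ge0_integral_density dg)//;
  [|by [exact: measurable_funepos|exact: measurable_funeneg]]);
  apply: eq_integral => x _; rewrite ?funeposE ?funenegE /=.
- by rewrite -!EFin_max -EFinM maxr_pMl// mul0r.
- by rewrite -!EFin_max -EFinM maxr_pMl// mul0r mulNr.
Qed.

Lemma integrable_density Q P g (f : T -> R) : has_density Q P g ->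
  measurable_fun setT f ->
  Q.-integrable setT (EFin \o f) <->
  P.-integrable setT (fun x => (f x * g x)%:E).
Proof.
move=> dg mf; have [mg g0 _] := dg.
have mfE : measurable_fun setT (EFin \o f) by exact/measurable_EFinP.
have mfg : measurable_fun setT (fun x => (f x * g x)%:E).
  by apply/measurable_EFinP; exact: measurable_funM.
have E : \int[Q]_x `|(f x)%:E| = \int[P]_x `|(f x * g x)%:E|.
  rewrite (ge0_integral_density dg)//; last exact: measurableT_comp.
  by apply: eq_integral => x _; rewrite /= normrM (ger0_norm (g0 x)).
by split=> /integrableP[_ h]; apply/integrableP; split=> //; rewrite ?E// -E.
Qed.

Lemma measurable_lne_fin (f : T -> \bar R) : measurable_fun setT f ->
  (forall x, f x \is a fin_num) -> measurable_fun setT (fun x => lne (f x)).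
Proof.
move=> mf ffin.
have mff : measurable_fun setT (fun x => fine (f x)) by exact: measurableT_comp.
rewrite (_ : (fun _ => _) = (fun x => if (fine (f x) <= 0)%R then -oo
    else (ln (fine (f x)))%:E)); last first.
  by apply/funext => x; rewrite -{1}(fineK (ffin x)).
apply: measurable_fun_ifT => //; first exact: measurable_fun_ler.
by apply/measurable_EFinP; apply: measurableT_comp.
Qed.

(* The entropy integrand [g ln g] may have no sign, whereas [kl g] is
   nonnegative; the two have the same integral because [g] has mass 1. *)
Lemma rel_entropyE Q P g : has_density Q P g ->
  rel_entropy Q P = \int[P]_x (kl (g x))%:E.
Proof.
move=> dg; have dQP := has_density_dominates dg; have [mg g0 Qg] := dg.
rewrite /rel_entropy; case: asboolP => // _.
set D := Radon_Nikodym _ _.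
have iD : P.-integrable setT D by exact: Radon_Nikodym_integrable.
have mlng : measurable_fun setT (fun x => ln (g x)) by exact: measurableT_comp.
have mE (f : T -> R) : measurable_fun setT f -> measurable_fun setT (EFin \o f).
  by move=> ?; exact/measurable_EFinP.
have -> : \int[Q]_x lne (D x) = \int[Q]_x (ln (g x))%:E.
  apply: ae_eq_integral => //.
  - apply: measurable_lne_fin; first exact: measurable_int iD.
    by move=> x; exact: Radon_Nikodym_fin_num.
  - exact: mE.
  (* Where [g] vanishes, [lne] is [-oo] while [ln] is finite; [Q] does not charge that set. *)
  have gpos : {ae Q, forall x, (0 < g x)%R}.
    exists [set x | g x <= 0]%R; split.
    - rewrite -[X in measurable X]setTI; exact: measurable_fun_ler.
    - rewrite Qg; last by rewrite -[X in measurable X]setTI; exact: measurable_fun_ler.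
      by apply: integral0_eq => x /= gx; congr (_%:E); apply/eqP; rewrite eq_le gx g0.
    - by move=> x /= /negP; rewrite -leNgt.
  have gD : ae_eq P setT (EFin \o g) D.
    apply: ae_eq_trans (density_ae_eq_RN dg) _.
    exact: (ae_eq_Radon_Nikodym_SigmaFinite dQP measurableT).
  have := null_dominates_ae_eq measurableT dQP gD.
  apply: filter_app; apply: filter_app gpos.
  by apply: aeW => x gx /(_ I) <- _; exact: lne_EFin.
pose lp x := Num.max (ln (g x)) 0%R; pose lm x := Num.max (- ln (g x))%R 0%R.
have mlp : measurable_fun setT lp by exact: measurable_maxr.
have mlm : measurable_fun setT lm.
  by apply: measurable_maxr => //; exact: measurable_funN.
have lp0 x : (0 <= lp x)%R by rewrite le_max lexx orbT.
have lm0 x : (0 <= lm x)%R by rewrite le_max lexx orbT.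
have lE x : ln (g x) = (lp x - lm x)%R.
  by rewrite /lp /lm; case: (leP (ln (g x)) 0%R) => h; case: (leP (- ln (g x))%R 0%R) => h'; lra.
rewrite integralE.
have -> : \int[Q]_x (fun x => (ln (g x))%:E)^\+ x = \int[P]_x (g x * lp x)%:E.
  rewrite (ge0_integral_density dg)//; last exact/measurable_funepos/mE.
  by apply: eq_integral => x _; rewrite funeposE -EFin_max -EFinM mulrC.
have -> : \int[Q]_x (fun x => (ln (g x))%:E)^\- x = \int[P]_x (g x * lm x)%:E.
  rewrite (ge0_integral_density dg)//; last exact/measurable_funeneg/mE.
  by apply: eq_integral => x _; rewrite funenegE -EFinN -EFin_max -EFinM mulrC.
have mglp : measurable_fun setT (fun x => g x * lp x)%R by exact: measurable_funM.
have mglm : measurable_fun setT (fun x => g x * lm x)%R by exact: measurable_funM.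
have mkl : measurable_fun setT (fun x => kl (g x)).
  exact: measurableT_comp measurable_kl mg.
have glp0 x : 0 <= (g x * lp x)%:E by rewrite lee_fin mulr_ge0.
have glm0 x : 0 <= (g x * lm x)%:E by rewrite lee_fin mulr_ge0.
have klg0 x : 0 <= (kl (g x))%:E by rewrite lee_fin kl_ge0.
(* The tangent at [1] gives [- g ln g <= 1 - g <= 1], so the negative part of the entropy is finite
   and may be subtracted. *)
have B1 : \int[P]_x (g x * lm x)%:E <= 1.
  have -> : 1 = \int[P]_x (cst 1 x) :> \bar R.
    by rewrite integral_prob_cst.
  apply: ge0_le_integral => //; first exact: mE.
  move=> x _; rewrite lee_fin /cst /=.
  have := kl_tangent (g0 x) ltr01.
  rewrite /kl ln1 mulr0 /lm; case: (leP (- ln (g x))%R 0%R) => _; first by rewrite mulr0; lra.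
  by have := g0 x; lra.
have Bfin : \int[P]_x (g x * lm x)%:E \is a fin_num.
  rewrite ge0_fin_numE ?integral_ge0//; first exact: le_lt_trans B1 (ltry _).
(* Only nonnegative functions occur on either side, so additivity holds even when the entropy is
   infinite. *)
have S : \int[P]_x (kl (g x))%:E + \int[P]_x (g x * lm x)%:E + \int[P]_x (g x)%:E =
    \int[P]_x (g x * lp x)%:E + \int[P]_x (cst 1 x).
  rewrite -!ge0_integralD//; try exact: mE; last 3 first.
  - by move=> x _; rewrite adde_ge0.
  - by apply: emeasurable_funD; exact: mE.
  - by move=> x _; rewrite lee_fin.
  by apply: eq_integral => x _; rewrite /= -!EFinD /kl lE; congr (_%:E); ring.
move: S; rewrite (has_density_int1 dg) integral_prob_cst.
move=> /(congr1 (fun z => z - 1 - \int[P]_x (g x * lm x)%:E)).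
by rewrite !addeK// => ->.
Qed.

Lemma rel_entropy_ge0 Q P : 0 <= rel_entropy Q P.
Proof.
have [/dominates_density[g dg]|nQP] := pselect (Q `<< P).
  rewrite (rel_entropyE dg); apply: integral_ge0 => x _.
  by rewrite lee_fin kl_ge0//; case: dg.
by rewrite /rel_entropy; case: asboolP => // _; exact: leey.
Qed.

Lemma has_density_exists P g : measurable_fun setT g ->
  (forall x, (0 <= g x)%R) -> \int[P]_x (g x)%:E = 1 ->
  exists Q : probability T R, has_density Q P g.
Proof.
move=> mg g0 g1.
pose m (A : set T) := \int[P]_(x in A) (g x)%:E.
have m0 : m set0 = 0 by rewrite /m integral_set0.
have m_ge0 A : 0 <= m A by apply: integral_ge0 => x _; rewrite lee_fin.
have msa : semi_sigma_additive m.
  apply: (semi_sigma_additive_nng_induced (f := EFin \o g)) => //.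
  exact/measurable_EFinP.
pose hm := isMeasure.Build _ _ _ m m0 m_ge0 msa.
pose mm : {measure set T -> \bar R} := HB.pack m hm.
pose hp := Measure_isProbability.Build _ _ _ mm g1.
pose Q : probability T R := HB.pack m hm hp.
by exists Q.
Qed.


End densities.

(** * Image measures and data processing *)

Section image_measure.
Context {d1 d2} {S : measurableType d1} {T : measurableType d2} {R : realType}.
Implicit Types (P : probability S R) (Q : probability T R) (phi : S -> T).

(** A relation between given measures, so that the prescribed marginals of a coupling are themselves
    images under the projections. *)
Definition is_image P phi Q :=
  measurable_fun setT phi /\ forall A, measurable A -> Q A = P (phi @^-1` A).

Lemma is_image_exists P phi : measurable_fun setT phi ->
  exists Q, is_image P phi Q.
Proof.
move=> mphi.
pose X : {mfun S >-> T} := HB.pack phi (isMeasurableFun.Build _ _ _ _ phi mphi).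
by exists (distribution P X : probability T R); split.
Qed.

Lemma ge0_integral_image P phi Q (f : T -> \bar R) : is_image P phi Q ->
  measurable_fun setT f -> (forall y, 0 <= f y) ->
  \int[Q]_y f y = \int[P]_x f (phi x).
Proof.
move=> [mphi Qphi] mf f0.
pose X : {mfun S >-> T} := HB.pack phi (isMeasurableFun.Build _ _ _ _ phi mphi).
rewrite (@eq_measure_integral _ _ _ _ (distribution P X))//; last first.
  by move=> A mA _; exact: Qphi.
by rewrite ge0_integral_distribution.
Qed.

Lemma integral_image P phi Q (f : T -> R) : is_image P phi Q ->
  measurable_fun setT f -> \int[Q]_y (f y)%:E = \int[P]_x (f (phi x))%:E.
Proof.
move=> im mf; have mfE : measurable_fun setT (EFin \o f) by exact/measurable_EFinP.
by rewrite integralE [RHS]integralE; congr (_ - _);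
  rewrite (ge0_integral_image im)//; by [exact: measurable_funepos
    |exact: measurable_funeneg|apply: eq_integral => x _; rewrite ?funeposE ?funenegE].
Qed.

Lemma integrable_image P phi Q (f : T -> R) : is_image P phi Q ->
  measurable_fun setT f ->
  Q.-integrable setT (EFin \o f) <-> P.-integrable setT (fun x => (f (phi x))%:E).
Proof.
move=> im mf; have [mphi _] := im.
have mfE : measurable_fun setT (EFin \o f) by exact/measurable_EFinP.
have mfphi : measurable_fun setT (fun x => (f (phi x))%:E).
  by apply/measurable_EFinP; exact: measurableT_comp.
have E : \int[Q]_y `|(f y)%:E| = \int[P]_x `|(f (phi x))%:E|.
  by rewrite (ge0_integral_image im)//; exact: measurableT_comp.
by split=> /integrableP[_ h]; apply/integrableP; split=> //; rewrite ?E// -E.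
Qed.

Lemma ae_image P phi Q (A : T -> Prop) : is_image P phi Q ->
  {ae Q, forall y, A y} -> {ae P, forall x, A (phi x)}.
Proof.
move=> [mphi Qphi] [N [mN QN AN]]; exists (phi @^-1` N); split.
- by rewrite -[X in measurable X]setTI; exact: mphi.
- by rewrite -Qphi.
- by move=> x; exact: AN.
Qed.

End image_measure.

Lemma measurable_fun_limn_einf d (T : measurableType d) (R : realType)
    (f : (T -> \bar R)^nat) : (forall n, measurable_fun setT (f n)) ->
  measurable_fun setT (fun x => limn_einf (f ^~ x)).
Proof.
move=> mf; apply: measurableT_comp => //; apply: measurable_fun_limn_esup => n.
exact: measurableT_comp.
Qed.

Section data_processing.
Context {d1 d2} {S : measurableType d1} {T : measurableType d2} {R : realType}.

Lemma bounded_integrable d (U : measurableType d) (P : probability U R)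
    (f : U -> R) (M : R) : measurable_fun setT f -> (forall x, `|f x| <= M)%R ->
  P.-integrable setT (EFin \o f).
Proof.
move=> mf fM; apply: measurable_bounded_integrable => //.
  by rewrite -ge0_fin_numE// fin_num_measure.
exists M; split; first exact: num_real.
by move=> N MN x _ /=; apply: le_trans (fM x) (ltW MN).
Qed.

(* [kl f >= f ln m - m + 1] for every constant [m > 0]; it is used with [m] the
   density of the image, truncated to [1/K, K] so that [ln m] is bounded. *)
Lemma data_processing (P G : probability S R) (P' Q : probability T R)
    (phi : S -> T) (f : S -> R) (h : T -> R) :
  is_image P phi P' -> is_image G phi Q ->
  has_density G P f -> has_density Q P' h ->
  \int[P']_y (kl (h y))%:E <= \int[P]_x (kl (f x))%:E.
Proof.
move=> imP imG df dh; have [mphi _] := imP.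
have [mf f0 _] := df; have [mh h0 _] := dh.
have mklf : measurable_fun setT (fun x => (kl (f x))%:E).
  by apply/measurable_EFinP; exact: measurableT_comp measurable_kl mf.
have [|infy] := ltP (\int[P]_x (kl (f x))%:E) +oo; last first.
  by move: infy; rewrite leye_eq => /eqP ->; rewrite leey.
move=> fin_klf.
have iklf : P.-integrable setT (fun x => (kl (f x))%:E).
  apply/integrableP; split => //; under eq_integral do rewrite /= ger0_norm ?kl_ge0//.
  exact: fin_klf.
pose m n y : R := (Num.min n.+1%:R (Num.max n.+1%:R^-1 (h y)))%R.
have n1 n : (0 < n.+1%:R^-1 :> R)%R by rewrite invr_gt0.
have n2 n : (n.+1%:R^-1 <= n.+1%:R :> R)%R.
  by rewrite (@le_trans _ _ 1%R)// ?invf_le1// ler1n.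
have m_lo n y : (n.+1%:R^-1 <= m n y)%R by rewrite /m le_min n2 le_max lexx.
have m_hi n y : (m n y <= n.+1%:R)%R by rewrite /m ge_min lexx.
have m_gt0 n y : (0 < m n y)%R by exact: lt_le_trans (n1 n) (m_lo n y).
have mm n : measurable_fun setT (m n).
  by apply: measurable_minr => //; exact: measurable_maxr.
have mlm n : measurable_fun setT (fun y => ln (m n y)) by exact: measurableT_comp.
have lm n y : (`|ln (m n y)| <= ln n.+1%:R)%R.
  rewrite ler_norml; apply/andP; split; last by rewrite ler_ln ?posrE.
  by rewrite -lnV ?posrE// ler_ln ?posrE.
pose low n y := (ln (m n y) * h y + (1 - m n y))%R.
have mlow n : measurable_fun setT (low n).
  apply: measurable_funD; first exact: measurable_funM.
  exact: measurable_funB.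
have low0 n y : (0 <= low n y)%R.
  by apply: kl_truncated_tangent_ge0; rewrite ?invf_le1 ?ler1n.
(* The tangent inequality is integrated over [P]. The point of tangency depends on [phi x] only and
   both [ln m] and [1 - m] are bounded, so the two terms can be separated and transported to [Q] and
   [P']. *)
have step n : \int[P']_y (low n y)%:E <= \int[P]_x (kl (f x))%:E.
  have b1 y : (`|1 - m n y| <= 1 + n.+1%:R)%R.
    have mgt0 := m_gt0 n y; have mhi := m_hi n y.
    by rewrite ler_norml; apply/andP; split; lra.
  have m1 : measurable_fun setT (fun y => 1 - m n y)%R by exact: measurable_funB.
  have iG : G.-integrable setT (EFin \o (fun x => ln (m n (phi x)))).
    apply: (@bounded_integrable _ _ _ _ (ln n.+1%:R)) => //.
    exact: (measurableT_comp (mlm n)).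
  have iQ : Q.-integrable setT (EFin \o (fun x => ln (m n x))).
    exact: (@bounded_integrable _ _ _ _ (ln n.+1%:R)).
  have iP : P.-integrable setT (EFin \o (fun x => 1 - m n (phi x)))%R.
    apply: (@bounded_integrable _ _ _ _ (1 + n.+1%:R)%R) => //.
    exact: (measurableT_comp m1).
  have iP' : P'.-integrable setT (EFin \o (fun x => 1 - m n x))%R.
    exact: (@bounded_integrable _ _ _ _ (1 + n.+1%:R)%R).
  have mlmphi : measurable_fun setT (fun x => ln (m n (phi x))).
    exact: (measurableT_comp (mlm n)).
  have iPf := (integrable_density df mlmphi).1 iG.
  have iPh := (integrable_density dh (mlm n)).1 iQ.
  have -> : \int[P']_y (low n y)%:E =
      \int[P]_x (ln (m n (phi x)) * f x + (1 - m n (phi x)))%:E.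
    under eq_integral do rewrite EFinD.
    rewrite integralD// -(integral_density dh)// (integral_image imG)//.
    rewrite (integral_density df)// (integral_image imP)//.
    by rewrite -integralD.
  apply: le_integral => //; first by under eq_fun do rewrite EFinD; exact: integrableD.
  by move=> x _; rewrite lee_fin; have := kl_tangent (f0 x) (m_gt0 n (phi x)); lra.
have mlowE n : measurable_fun setT (fun y => (low n y)%:E) by exact/measurable_EFinP.
apply: (@le_trans _ _ (\int[P']_y limn_einf (fun n => (low n y)%:E))); last first.
  apply: (le_trans (fatou P' measurableT mlowE _)); first by move=> n y _; rewrite lee_fin.
  apply: le_trans (le_limn_einf (nearW _ step)) _.
  by rewrite (cvg_limn_einf_sup (cvg_cst _)).1.
apply: ge0_le_integral => //.
- by move=> y _; rewrite lee_fin kl_ge0.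
- by apply/measurable_EFinP; exact: measurableT_comp measurable_kl mh.
- exact: measurable_fun_limn_einf.
(* Where [h] vanishes, the tangent at [1/(n+1)] has value [1 - 1/(n+1)], which tends to [kl 0].
   Elsewhere the truncation is eventually inactive and the tangent touches [kl] at [h y]. *)
move=> y _; have := h0 y; rewrite le_eqVlt => /predU1P[hy0|hy0].
  have -> : (fun n => (low n y)%:E) = (fun n => (1 - harmonic n)%:E).
    apply/funext => n /=; rewrite /low -hy0 mulr0 add0r /m -hy0.
    by rewrite (max_idPl (ltW (n1 n))) (min_idPr (n2 n)).
  have : (1 - harmonic n)%:E @[n --> \oo] --> (1 - 0 : R)%:E.
    apply: cvg_EFin; first by near=> n.
    by apply: cvgB; [exact: cvg_cst|exact: cvg_harmonic].
  by move/cvg_limn_einf_sup => -[-> _]; rewrite lee_fin -hy0 /kl; lra.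
have : (low n y)%:E @[n --> \oo] --> (kl (h y))%:E.
  apply: cvg_near_cst; near=> n.
  have hi : (h y <= n.+1%:R)%R.
    apply: (@le_trans _ _ n%:R%R); last by rewrite ler_nat.
    by near: n; exact: nbhs_infty_ger.
  have lo : (n.+1%:R^-1 <= h y)%R.
    apply: ltW; near: n; exact: (near_infty_natSinv_lt (PosNum hy0)).
  rewrite /low /m (max_idPr lo) (min_idPr hi) /kl; congr (_%:E); ring.
by move/cvg_limn_einf_sup => -[-> _].
Unshelve. all: by end_near. Qed.
End data_processing.

(** * Densities of couplings and their barycenters *)

Section coupling_density.
Context {d1 d2} {T : measurableType d1} {U : measurableType d2} {R : realType}.
Implicit Types (P : probability T R) (N : probability U R) (f : T * U -> R).

(** The slice conditions say that the measure with density [f] has marginals [P] and [N]. The first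
    space is left arbitrary because gluing uses it with a space of pairs. *)
Definition coupling_density P N f :=
  [/\ measurable_fun setT f, forall z, (0 <= f z)%R,
      {ae P, forall t, \int[N]_u (f (t, u))%:E = 1} &
      {ae N, forall u, \int[P]_t (f (t, u))%:E = 1}].

Variables (P : probability T R) (N : probability U R).

Lemma ge0_integral_fst f (G : T -> \bar R) : coupling_density P N f ->
  measurable_fun setT G -> (forall t, 0 <= G t) ->
  \int[P \x N]_z (G z.1 * (f z)%:E) = \int[P]_t G t.
Proof.
move=> [mf f0 f1 _] mG G0.
have mfE : measurable_fun setT (EFin \o f) by exact/measurable_EFinP.
have mGf : measurable_fun setT (fun z : T * U => G z.1 * (f z)%:E).
  by apply: emeasurable_funM => //; exact: measurableT_comp.
have Gf0 (z : T * U) : 0 <= G z.1 * (f z)%:E by rewrite mule_ge0// lee_fin.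
rewrite fubini_tonelli1//; apply: ge0_ae_eq_integral => //.
- exact: measurable_fun_fubini_tonelli_F.
- by move=> t _; apply: integral_ge0.
apply: filter_app f1; apply: aeW => t ft _; rewrite /fubini_F /=.
rewrite ge0_integralZl//; first by rewrite ft mule1.
- exact: (measurableT_comp mfE).
- by move=> u _; rewrite lee_fin.
Qed.

Lemma ge0_integral_snd f (G : U -> \bar R) : coupling_density P N f ->
  measurable_fun setT G -> (forall u, 0 <= G u) ->
  \int[P \x N]_z (G z.2 * (f z)%:E) = \int[N]_u G u.
Proof.
move=> [mf f0 _ f1] mG G0.
have mfE : measurable_fun setT (EFin \o f) by exact/measurable_EFinP.
have mGf : measurable_fun setT (fun z : T * U => G z.2 * (f z)%:E).
  by apply: emeasurable_funM => //; exact: measurableT_comp.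
have Gf0 (z : T * U) : 0 <= G z.2 * (f z)%:E by rewrite mule_ge0// lee_fin.
rewrite fubini_tonelli2//; apply: ge0_ae_eq_integral => //.
- exact: measurable_fun_fubini_tonelli_G.
- by move=> u _; apply: integral_ge0.
apply: filter_app f1; apply: aeW => u fu _; rewrite /fubini_G /=.
rewrite ge0_integralZl//; first by rewrite fu mule1.
- exact: (measurableT_comp mfE).
- by move=> t _; rewrite lee_fin.
Qed.

Lemma coupling_density_int1 f : coupling_density P N f ->
  \int[P \x N]_z (f z)%:E = 1.
Proof.
move=> cf; have := ge0_integral_fst cf (measurable_cst 1) (fun=> lee01).
by rewrite integral_prob_cst => <-; apply: eq_integral => z _; rewrite mul1e.
Qed.

Lemma has_density_setX (Q : probability (T * U)%type R) f (A : set (T * U)) :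
  has_density Q (P \x N) f -> measurable A ->
  Q A = \int[P \x N]_z ((\1_A z)%:E * (f z)%:E).
Proof.
move=> [mf f0 Qf] mA; rewrite Qf// integral_mkcond epatch_indic.
by apply: eq_integral => z _; rewrite /= muleC.
Qed.

(** By Tonelli the integrated slices are the densities of the marginals of [Q], and densities are
    unique almost everywhere. *)
Lemma coupling_density_marginals (Q : probability (T * U)%type R) f :
  has_density Q (P \x N) f ->
  coupling_density P N f <->
  (forall A, measurable A -> Q (fst @^-1` A) = P A) /\
  (forall B, measurable B -> Q (snd @^-1` B) = N B).
Proof.
move=> df; have [mf f0 Qf] := df.
have mfE : measurable_fun setT (EFin \o f) by exact/measurable_EFinP.
have f0E z : 0 <= (EFin \o f) z by rewrite lee_fin.
have mfst A : measurable A -> measurable (fst @^-1` A : set (T * U)).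
  by move=> mA; rewrite -[X in measurable X]setTI; exact: measurable_fst.
have msnd A : measurable A -> measurable (snd @^-1` A : set (T * U)).
  by move=> mA; rewrite -[X in measurable X]setTI; exact: measurable_snd.
have mind d (V : measurableType d) (A : set V) : measurable A ->
    measurable_fun setT (EFin \o (\1_A : V -> R)).
  by move=> mA; apply/measurable_EFinP; exact: measurable_indic.
have QA A : measurable A ->
    Q (fst @^-1` A) = \int[P]_(t in A) \int[N]_u (f (t, u))%:E.
  move=> mA; rewrite (has_density_setX df)//; last exact: mfst.
  rewrite fubini_tonelli1//; last 2 first.
  - by apply: emeasurable_funM => //; apply: mind; exact: mfst.
  - by move=> z; rewrite mule_ge0 ?lee_fin.
  rewrite [RHS]integral_mkcond epatch_indic; apply: eq_integral => t _.
  rewrite /fubini_F/= muleC -ge0_integralZl ?lee_fin//.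
  - exact: (measurableT_comp mfE).
  - by move=> u _; rewrite lee_fin.
have QB B : measurable B ->
    Q (snd @^-1` B) = \int[N]_(u in B) \int[P]_t (f (t, u))%:E.
  move=> mB; rewrite (has_density_setX df)//; last exact: msnd.
  rewrite fubini_tonelli2//; last 2 first.
  - by apply: emeasurable_funM => //; apply: mind; exact: msnd.
  - by move=> z; rewrite mule_ge0 ?lee_fin.
  rewrite [RHS]integral_mkcond epatch_indic; apply: eq_integral => u _.
  rewrite /fubini_G/= muleC -ge0_integralZl ?lee_fin//.
  - exact: (measurableT_comp mfE).
  - by move=> t _; rewrite lee_fin.
have mF : measurable_fun setT (fun t => \int[N]_u (f (t, u))%:E).
  exact: (measurable_fun_fubini_tonelli_F (EFin \o f)).
have mG : measurable_fun setT (fun u => \int[P]_t (f (t, u))%:E).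
  exact: (measurable_fun_fubini_tonelli_G (EFin \o f)).
have i1 d (V : measurableType d) (M : probability V R) :
    M.-integrable setT (cst 1 : V -> \bar R).
  exact: (finite_measure_integrable_cst M 1 (A := setT)).
have intc d (V : measurableType d) (M : probability V R) A : measurable A ->
    \int[M]_(x in A) (cst 1 x) = M A.
  by move=> mA; rewrite integral_cst// mul1e.
split=> [[_ _ f1 f2]|[Q1 Q2]].
  split=> A mA.
    rewrite QA// -[RHS]intc//; apply: ae_eq_integral => //.
    - exact: measurable_funTS.
    - by apply: filter_app f1; apply: aeW => t ->.
  rewrite QB// -[RHS]intc//; apply: ae_eq_integral => //.
  - exact: measurable_funTS.
  - by apply: filter_app f2; apply: aeW => t ->.
split=> //.
- have : ae_eq P setT (cst 1) (fun t => \int[N]_u (f (t, u))%:E).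
    by apply: integral_ae_eq => //; [exact: i1|move=> E _ mE; rewrite intc// -QA// Q1].
  by apply: filter_app; apply: aeW => t /(_ I) <-.
- have : ae_eq N setT (cst 1) (fun u => \int[P]_t (f (t, u))%:E).
    by apply: integral_ae_eq => //; [exact: i1|move=> E _ mE; rewrite intc// -QB// Q2].
  by apply: filter_app; apply: aeW => t /(_ I) <-.
Qed.

End coupling_density.

Section square_integrable.
Context {d} {T : measurableType d} {R : realType} (P : probability T R).
Implicit Types x y : T -> R.

Definition sq_integrable x :=
  measurable_fun setT x /\ P.-integrable setT (fun t => (x t ^+ 2)%:E).

Lemma sq_integrable_le x (G : T -> \bar R) : measurable_fun setT x ->
  measurable_fun setT G -> (forall t, 0 <= G t) -> \int[P]_t G t < +oo ->
  {ae P, forall t, (x t ^+ 2)%:E <= G t} -> sq_integrable x.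
Proof.
move=> mx mG G0 Goo xG; split=> //.
have mx2 : measurable_fun setT (fun t => (x t ^+ 2)%:E).
  by apply/measurable_EFinP; exact: measurable_funX.
apply/integrableP; split => //; apply: le_lt_trans Goo.
apply: ae_ge0_le_integral => //; first exact: measurableT_comp.
by apply: filter_app xG; apply: aeW => t h _; rewrite gee0_abs// lee_fin sqr_ge0.
Qed.

Lemma sq_integrable_cst (c : R) : sq_integrable (cst c).
Proof. by split=> //; exact: (finite_measure_integrable_cst P (c ^+ 2)). Qed.

Lemma sq_integrableM x y : sq_integrable x -> sq_integrable y ->
  P.-integrable setT (fun t => (x t * y t)%:E).
Proof.
move=> [mx ix] [my iy].
apply: (le_integrable measurableT _ _ (integrableD measurableT ix iy)).
  by apply/measurable_EFinP; exact: measurable_funM.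
move=> t _; rewrite /= lee_fin (ger0_norm (addr_ge0 (sqr_ge0 _) (sqr_ge0 _))).
have := sqr_ge0 (x t - y t)%R; have := sqr_ge0 (x t + y t)%R => ? ?.
by rewrite ler_norml; apply/andP; split; nra.
Qed.

Lemma sq_integrable_integrable x : sq_integrable x ->
  P.-integrable setT (EFin \o x).
Proof.
move=> /sq_integrableM/(_ (sq_integrable_cst 1)).
by apply: eq_integrable => // t _; rewrite /= mulr1.
Qed.

Lemma sq_integrableZ (c : R) x : sq_integrable x ->
  sq_integrable (fun t => c * x t)%R.
Proof.
move=> [mx ix]; split; first exact: measurable_funM.
have := integrableZl measurableT (c ^+ 2) ix.
by apply: eq_integrable => // t _; rewrite exprMn.
Qed.

Lemma sq_integrableD x y : sq_integrable x -> sq_integrable y ->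
  sq_integrable (fun t => x t + y t)%R.
Proof.
move=> ix iy; have [mx ix2] := ix; have [my iy2] := iy.
split; first exact: measurable_funD.
have ixy := integrableZl measurableT 2 (sq_integrableM ix iy).
have := integrableD measurableT (integrableD measurableT ix2 iy2) ixy.
by apply: eq_integrable => // t _; rewrite /= -EFinM -!EFinD; congr (_%:E); ring.
Qed.

Lemma sq_integrableB x y : sq_integrable x -> sq_integrable y ->
  sq_integrable (fun t => x t - y t)%R.
Proof.
move=> ix /(sq_integrableZ (-1)%R) iy.
have [m i] := sq_integrableD ix iy.
have E : (fun t => x t - y t)%R = (fun t => x t + (-1) * y t)%R.
  by apply/funext => t; rewrite mulN1r.
by rewrite E.
Qed.

End square_integrable.

Lemma sq_integrable_image {d1 d2} {S : measurableType d1} {T : measurableType d2}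
    {R : realType} (P : probability S R) (Q : probability T R) (phi : S -> T)
    (x : T -> R) :
  is_image P phi Q -> measurable_fun setT x ->
  sq_integrable Q x <-> sq_integrable P (fun s => x (phi s)).
Proof.
move=> im mx; have [mphi _] := im.
have mx2 : measurable_fun setT (fun y => x y ^+ 2)%R by exact: measurable_funX.
split=> [[_ i]|[_ i]].
  by split; [exact: measurableT_comp|exact: (integrable_image im mx2).1].
by split=> //; exact: (integrable_image im mx2).2.
Qed.

Section barycenter.
Context {d1 d2} {T : measurableType d1} {U : measurableType d2} {R : realType}.

(** The conditional expectation of [g] given [t]. When [g] is [N]-integrable and [f] is a coupling
    density, [fine] meets an infinite integral only on a [P]-null set of [t]. *)
Definition bary (N : probability U R) (g : U -> R) (f : T * U -> R) (t : T) : R :=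
  fine (\int[N]_u (g u * f (t, u))%:E).

Variables (P : probability T R) (N : probability U R) (f : T * U -> R).
Hypothesis cf : coupling_density P N f.

Let mf : measurable_fun setT f. Proof. by case: cf. Qed.
Let f0 z : (0 <= f z)%R. Proof. by case: cf. Qed.
Let mfE : measurable_fun setT (EFin \o f). Proof. exact/measurable_EFinP. Qed.

Lemma integrable_fst (x : T -> R) : P.-integrable setT (EFin \o x) ->
  (P \x N).-integrable setT (fun z => (x z.1 * f z)%:E).
Proof.
move=> /integrableP[/measurable_EFinP mx ix]; apply/integrableP; split.
  apply/measurable_EFinP; apply: measurable_funM => //.
  exact: measurableT_comp.
move: ix; rewrite -(ge0_integral_fst cf)//; last first.
  by do 2 apply: measurableT_comp => //.
apply: le_lt_trans; rewrite le_eqVlt; apply/orP; left; apply/eqP.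
by apply: eq_integral => z _; rewrite /= normrM (ger0_norm (f0 z)).
Qed.

Lemma integrable_snd (g : U -> R) : N.-integrable setT (EFin \o g) ->
  (P \x N).-integrable setT (fun z => (g z.2 * f z)%:E).
Proof.
move=> /integrableP[/measurable_EFinP mg ig]; apply/integrableP; split.
  apply/measurable_EFinP; apply: measurable_funM => //.
  exact: measurableT_comp.
move: ig; rewrite -(ge0_integral_snd cf)//; last first.
  by do 2 apply: measurableT_comp => //.
apply: le_lt_trans; rewrite le_eqVlt; apply/orP; left; apply/eqP.
by apply: eq_integral => z _; rewrite /= normrM (ger0_norm (f0 z)).
Qed.

Lemma measurable_bary (g : U -> R) : N.-integrable setT (EFin \o g) ->
  measurable_fun setT (bary N g f).
Proof.
move=> ig; apply: measurableT_comp => //.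
exact: measurable_int (integrable_fubini_F (integrable_snd ig)).
Qed.

Lemma ae_integrable_bary (g : U -> R) : N.-integrable setT (EFin \o g) ->
  {ae P, forall t, N.-integrable setT (fun u => (g u * f (t, u))%:E)}.
Proof. by move=> ig; exact: ae_integrable1 (integrable_snd ig). Qed.

Lemma baryE (g : U -> R) t :
  N.-integrable setT (fun u => (g u * f (t, u))%:E) ->
  \int[N]_u (g u * f (t, u))%:E = (bary N g f t)%:E.
Proof. by move=> i; rewrite /bary fineK// integrable_fin_num. Qed.

(** Conditional Jensen: with [b] the barycenter at [t], integrating [2 b g - b^2 <= g^2] against the
    slice gives [b^2] below the slice integral of [g^2], and the second marginal makes the latter
    integrable in [t]. *)
Lemma sq_integrable_bary (g : U -> R) : sq_integrable N g ->
  sq_integrable P (bary N g f).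
Proof.
move=> ig; have [mg ig2] := ig; have ig1 := sq_integrable_integrable ig.
have mF : measurable_fun setT (fun z : T * U => (g z.2 ^+ 2)%:E * (f z)%:E).
  apply: emeasurable_funM => //; apply/measurable_EFinP.
  by apply: measurable_funX; exact: measurableT_comp.
have F0 (z : T * U) : 0 <= (g z.2 ^+ 2)%:E * (f z)%:E.
  by apply: mule_ge0; rewrite lee_fin ?sqr_ge0.
apply: (@sq_integrable_le _ _ _ _ _ (fun t => \int[N]_u ((g u ^+ 2)%:E * (f (t, u))%:E))).
- exact: measurable_bary.
- exact: (measurable_fun_fubini_tonelli_F _ mF F0).
- by move=> t; apply: integral_ge0 => u _; exact: (F0 (t, u)).
- rewrite -[X in X < _](fubini_tonelli1 _ mF F0).
  rewrite (ge0_integral_snd cf (G := fun u => (g u ^+ 2)%:E))//.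
  + exact: integrable_lty.
  + by apply/measurable_EFinP; exact: measurable_funX.
  + by move=> u; rewrite lee_fin sqr_ge0.
have [_ _ f1 _] := cf.
have i2 := ae_integrable_bary ig2.
have i1 := ae_integrable_bary ig1.
apply: filter_app f1; apply: filter_app i1; apply: filter_app i2; apply: aeW.
move=> t i2 i1 f1; set b := bary N g f t.
have if1 : N.-integrable setT (fun u => (f (t, u))%:E).
  apply/integrableP; split; first exact: (measurableT_comp mfE).
  by under eq_integral do rewrite gee0_abs ?lee_fin//; rewrite f1 ltry.
have i1' := integrableZl measurableT (2 * b)%R i1.
have if1' := integrableZl measurableT (b ^+ 2)%R if1.
have : \int[N]_u ((2 * b)%:E * (g u * f (t, u))%:E - (b ^+ 2)%:E * (f (t, u))%:E) <=
    \int[N]_u ((g u ^+ 2) * f (t, u))%:E.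
  apply: le_integral => //; first exact: integrableB.
  move=> u _; rewrite -!EFinM -EFinB lee_fin.
  by have := mulr_ge0 (sqr_ge0 (g u - b)%R) (f0 (t, u)); lra.
rewrite integralB// !integralZl// f1 (baryE i1) -/b mule1 -EFinM -EFinB.
by under eq_integral do rewrite EFinM; apply: le_trans; rewrite lee_fin; lra.
Qed.

Lemma integrable_pairing (x : T -> R) (g : U -> R) :
  sq_integrable P x -> sq_integrable N g ->
  (P \x N).-integrable setT (fun z => (x z.1 * g z.2 * f z)%:E).
Proof.
move=> [mx ix] [mg ig].
apply: (le_integrable measurableT _ _
  (integrableD measurableT (integrable_fst ix) (integrable_snd ig))).
  apply/measurable_EFinP; apply: measurable_funM => //.
  by apply: measurable_funM; exact: measurableT_comp.
move=> z _; rewrite /= lee_fin -mulrDl !normrM ler_wpM2r//.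
rewrite (ger0_norm (addr_ge0 (sqr_ge0 _) (sqr_ge0 _))) -normrM.
have := sqr_ge0 (x z.1 - g z.2)%R; have := sqr_ge0 (x z.1 + g z.2)%R => ? ?.
by rewrite ler_norml; apply/andP; split; nra.
Qed.

Lemma integral_pairing (x : T -> R) (g : U -> R) :
  sq_integrable P x -> sq_integrable N g ->
  \int[P \x N]_z (x z.1 * g z.2 * f z)%:E = \int[P]_t (x t * bary N g f t)%:E.
Proof.
move=> ix ig; have i := integrable_pairing ix ig.
have ig1 := sq_integrable_integrable ig.
rewrite -(integral12_prod_meas1 i); apply: ae_eq_integral => //.
- exact: measurable_int (integrable_fubini_F i).
- by apply/measurable_EFinP; apply: measurable_funM; [case: ix|exact: measurable_bary].
have := ae_integrable_bary ig1; apply: filter_app; apply: aeW => t it _.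
rewrite /fubini_F/= EFinM -(baryE it) -integralZl//.
by apply: eq_integral => u _; rewrite -EFinM mulrA.
Qed.

End barycenter.

(** * Dominated limits of densities *)

Section dominated_limit.
Context {d1 d2} {T : measurableType d1} {U : measurableType d2} {R : realType}.

Lemma dominated_cvg_fin {d} {V : measurableType d} (M : probability V R)
    (h_ : (V -> R)^nat) (h : V -> R) (G : V -> \bar R) :
  (forall n, measurable_fun setT (h_ n)) -> measurable_fun setT h ->
  M.-integrable setT G -> (forall n v, `|h_ n v|%:E <= G v) ->
  (forall v, G v < +oo -> h_ ^~ v @ \oo --> h v) ->
  M.-integrable setT (EFin \o h) /\
  \int[M]_v (h_ n v)%:E @[n --> \oo] --> \int[M]_v (h v)%:E.
Proof.
move=> mh_ mh iG hG cvh.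
have [] := @dominated_convergence _ _ _ M setT measurableT
  (fun n v => (h_ n v)%:E) (EFin \o h) G; last by move=> ? _ ?; split.
- by move=> n; exact/measurable_EFinP.
- exact/measurable_EFinP.
- have := integrable_ae measurableT iG; apply: filter_app; apply: aeW.
  move=> v /(_ I) Gv _; apply: cvg_EFin; first by near=> n.
  by apply: cvh; rewrite ltey_eq Gv.
- exact: iG.
- by apply: aeW => v n _; rewrite abse_EFin; exact: hG.
Unshelve. all: by end_near. Qed.

(** [D] is extended-real because it arises as the sum of a series. Integrability of [w D], and not
    only of [D], is what survives multiplication by a coordinate; a common dominant, rather than L^1
    convergence alone, gives limits on almost every slice. *)
Definition dominated_limit (P : probability T R) (N : probability U R)
    (w : U -> R) (f_ : (T * U -> R)^nat) (f : T * U -> R) :=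
  exists D : T * U -> \bar R, [/\ measurable_fun setT D, forall z, 0 <= D z,
    \int[P \x N]_z ((w z.2)%:E * D z) < +oo, forall n z, (f_ n z)%:E <= D z &
    forall z, D z < +oo -> f_ ^~ z @ \oo --> f z].

Variables (P : probability T R) (N : probability U R) (w : U -> R).
Hypothesis mw : measurable_fun setT w.
Hypothesis w1 : forall u, (1 <= w u)%R.
Variables (f_ : (T * U -> R)^nat) (f : T * U -> R).
Hypothesis cf_ : forall n, coupling_density P N (f_ n).
Hypothesis mf : measurable_fun setT f.
Hypothesis f0 : forall z, (0 <= f z)%R.
Hypothesis lf : dominated_limit P N w f_ f.

Let w0 u : (0 <= w u)%R. Proof. exact: le_trans (w1 u). Qed.

Let mf_ n : measurable_fun setT (f_ n). Proof. by have [] := cf_ n. Qed.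

Let f0_ n z : (0 <= f_ n z)%R. Proof. by have [] := cf_ n. Qed.

Lemma integrable_dominant (D : T * U -> \bar R) : measurable_fun setT D ->
  (forall z, 0 <= D z) -> \int[P \x N]_z ((w z.2)%:E * D z) < +oo ->
  (P \x N).-integrable setT D.
Proof.
move=> mD D0 Doo; apply/integrableP; split => //; apply: le_lt_trans Doo.
apply: ge0_le_integral => //.
- exact: measurableT_comp.
- apply: emeasurable_funM => //; apply/measurable_EFinP.
  exact: measurableT_comp.
- by move=> z _; rewrite gee0_abs// lee_pemull ?lee_fin.
Qed.

(** By Fubini [w D] is integrable on almost every slice, where it dominates all [g f_n]. Since
    [w >= 1], finiteness of [w D] forces finiteness of [D], hence convergence of the densities. *)
Lemma cvg_bary (g : U -> R) : measurable_fun setT g ->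
  (forall u, `|g u| <= w u)%R ->
  {ae P, forall t, N.-integrable setT (fun u => (g u * f (t, u))%:E) /\
    \int[N]_u (g u * f_ n (t, u))%:E @[n --> \oo] -->
    \int[N]_u (g u * f (t, u))%:E}.
Proof.
move=> mg gw; have [D [mD D0 Doo fD cvf]] := lf.
have mwD : measurable_fun setT (fun z : T * U => (w z.2)%:E * D z).
  apply: emeasurable_funM => //; apply/measurable_EFinP.
  exact: measurableT_comp.
have wD0 (z : T * U) : 0 <= (w z.2)%:E * D z by rewrite mule_ge0 ?lee_fin.
have iwD : (P \x N).-integrable setT (fun z => (w z.2)%:E * D z).
  apply/integrableP; split => //.
  by under eq_integral do rewrite gee0_abs//.
have := ae_integrable1 iwD; apply: filter_app; apply: aeW => t it.
apply: (dominated_cvg_fin (h_ := fun n u => (g u * f_ n (t, u))%R)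
  (h := fun u => (g u * f (t, u))%R) _ _ it) => //.
- move=> n; apply: measurable_funM => //; exact: measurableT_comp (mf_ n) _.
- by apply: measurable_funM => //; exact: measurableT_comp mf _.
- move=> n u; rewrite normrM (ger0_norm (f0_ _ _)) EFinM.
  by apply: lee_pmul; rewrite ?lee_fin.
- move=> u; rewrite /= => wDu; apply: cvgM; first exact: cvg_cst.
  apply: cvf; rewrite ltey; apply/eqP => Dy; move: wDu.
  by rewrite Dy gt0_muley ?ltxx// lte_fin (lt_le_trans ltr01).
Qed.

Lemma coupling_density_limit : coupling_density P N f.
Proof.
split=> //.
- have g1 u : (`|cst 1 u| <= w u)%R by rewrite normr1.
  have := cvg_bary (measurable_cst _) g1.
  have : {ae P, forall t, forall n, \int[N]_u (f_ n (t, u))%:E = 1}.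
    by apply: ae_foralln => n; have [] := cf_ n.
  move=> h1 h2; apply: filter_app h1; apply: filter_app h2; apply: aeW.
  move=> t [_ ct] f1.
  have : cvg_to (\int[N]_u (cst 1 u * f_ n (t, u))%:E @[n --> \oo]) (nbhs (1 : \bar R)).
    have -> : (fun n => \int[N]_u (cst 1 u * f_ n (t, u))%:E) = cst 1.
      apply/funext => n; rewrite -(f1 n); apply: eq_integral => u _.
      by rewrite mul1r.
    exact: cvg_cst.
  move=> /(cvg_unique _ ct) E; rewrite -E//.
  by apply: eq_integral => u _; rewrite mul1r.
- have [D [mD D0 Doo fD cvf]] := lf.
  have iD := integrable_dominant mD D0 Doo.
  have := ae_integrable2 iD.
  have : {ae N, forall u, forall n, \int[P]_t (f_ n (t, u))%:E = 1}.
    by apply: ae_foralln => n; have [] := cf_ n.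
  move=> h1 h2; apply: filter_app h1; apply: filter_app h2; apply: aeW.
  move=> u iu f1.
  have [] := @dominated_cvg_fin _ _ P (fun n t => f_ n (t, u)) (fun t => f (t, u)) _ _ _ iu.
  + by move=> n; exact: measurableT_comp (mf_ n) _.
  + exact: measurableT_comp mf _.
  + by move=> n t; rewrite ger0_norm.
  + by move=> t; exact: cvf.
  move=> _; have -> : (fun n => \int[P]_t (f_ n (t, u))%:E) = cst 1.
    exact/funext.
  by move=> /(cvg_unique _ (cvg_cst _)) ->.
Qed.

Lemma entropy_lsc : \int[P \x N]_z (kl (f z))%:E <=
  limn_einf (fun n => \int[P \x N]_z (kl (f_ n z))%:E).
Proof.
have [D [mD D0 Doo fD cvf]] := lf.
have mkl h : measurable_fun setT h ->
    measurable_fun setT (fun z : T * U => (kl (h z))%:E).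
  by move=> mh; apply/measurable_EFinP; exact: measurableT_comp measurable_kl mh.
apply: (@le_trans _ _ (\int[P \x N]_z limn_einf (fun n => (kl (f_ n z))%:E))); last first.
  apply: fatou => // [n|n z _]; first exact: mkl.
  by rewrite lee_fin kl_ge0.
apply: ae_ge0_le_integral => //.
- by move=> z _; rewrite lee_fin kl_ge0.
- exact: mkl.
- by move=> z _; apply: limn_einf_ge0 => n; rewrite lee_fin kl_ge0.
- by apply: measurable_fun_limn_einf => n; exact: mkl.
have iD := integrable_dominant mD D0 Doo.
have := integrable_ae measurableT iD; apply: filter_app; apply: aeW.
move=> z /(_ I) Dz _; apply: kl_lsc => //.
by apply: cvf; rewrite ltey_eq Dz.
Qed.

End dominated_limit.

(** * Minimizing the penalized entropy *)

Section entropy_minimizers.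
Context {d1 d2} {T : measurableType d1} {U : measurableType d2} {R : realType}.
Implicit Types (f g : T * U -> R).

Lemma ge0_integral_convex {d} {V : measurableType d} (M : probability V R)
    (x y : V -> R) (s : R) :
  measurable_fun setT x -> measurable_fun setT y ->
  (forall v, 0 <= x v)%R -> (forall v, 0 <= y v)%R -> (0 <= s <= 1)%R ->
  \int[M]_v ((1 - s) * x v + s * y v)%:E =
  (1 - s)%:E * \int[M]_v (x v)%:E + s%:E * \int[M]_v (y v)%:E.
Proof.
move=> mx my x0 y0 /andP[s0 s1].
have s1' : (0 <= 1 - s)%R by rewrite subr_ge0.
have mE (z : V -> R) : measurable_fun setT z -> measurable_fun setT (EFin \o z).
  by move=> ?; exact/measurable_EFinP.
rewrite -!ge0_integralZl_EFin//; try exact: mE; last 2 first.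
- by move=> v _; rewrite lee_fin.
- by move=> v _; rewrite lee_fin.
rewrite -ge0_integralD//.
- by move=> v _; rewrite -EFinM lee_fin mulr_ge0.
- by apply: mE; exact: measurable_funM.
- by move=> v _; rewrite -EFinM lee_fin mulr_ge0.
- by apply: mE; exact: measurable_funM.
Qed.

Variables (P : probability T R) (N : probability U R).
Local Notation K := (coupling_density P N).
Local Notation ent f := (\int[P \x N]_z (kl (f z))%:E).

Lemma coupling_density_convex f g (s : R) : K f -> K g -> (0 <= s <= 1)%R ->
  K (fun z => (1 - s) * f z + s * g z)%R.
Proof.
move=> [mf f0 f1 f2] [mg g0 g1 g2] s01; have /andP[s0 s1] := s01.
have s1' : (0 <= 1 - s)%R by rewrite subr_ge0.
split.
- by apply: measurable_funD; exact: measurable_funM.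
- by move=> z; rewrite addr_ge0// mulr_ge0.
- apply: filter_app f1; apply: filter_app g1; apply: aeW => t g1 f1.
  rewrite ge0_integral_convex//; last 2 first.
  + exact: measurableT_comp mf _.
  + exact: measurableT_comp mg _.
  by rewrite f1 g1 !mule1 -EFinD subrK.
- apply: filter_app f2; apply: filter_app g2; apply: aeW => u g2 f2.
  rewrite ge0_integral_convex//; last 2 first.
  + exact: measurableT_comp mf _.
  + exact: measurableT_comp mg _.
  by rewrite f2 g2 !mule1 -EFinD subrK.
Qed.

Lemma coupling_density_mid f g : K f -> K g -> K (fun z => (f z + g z) / 2)%R.
Proof.
move=> kf kg; have := coupling_density_convex (s := 2^-1) kf kg.
have -> : (fun z => (1 - 2^-1) * f z + 2^-1 * g z)%R = (fun z => (f z + g z) / 2)%R.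
  by apply/funext => z; field.
by apply; apply/andP; split; lra.
Qed.

Lemma entropy_convex f g (s : R) : K f -> K g -> (0 <= s <= 1)%R ->
  ent (fun z => (1 - s) * f z + s * g z)%R <= (1 - s)%:E * ent f + s%:E * ent g.
Proof.
move=> kf kg s01; have [mf f0 _ _] := kf; have [mg g0 _ _] := kg.
have [mh h0 _ _] := coupling_density_convex kf kg s01.
have mkl h : measurable_fun setT h -> measurable_fun setT (fun z : T * U => kl (h z)).
  by move=> mh'; exact: measurableT_comp measurable_kl mh'.
rewrite -ge0_integral_convex//; try exact: mkl; try by move=> z; rewrite kl_ge0.
apply: ge0_le_integral => //.
- by move=> z _; rewrite lee_fin kl_ge0.
- by apply/measurable_EFinP; exact: mkl.
- by apply/measurable_EFinP; apply: measurable_funD; apply: measurable_funM => //; exact: mkl.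
- by move=> z _; rewrite lee_fin kl_convex.
Qed.

Variable w : U -> R.
Hypothesis w1 : forall u, (1 <= w u)%R.
Hypothesis sqw : sq_integrable N w.

Let w0 u : (0 <= w u)%R. Proof. exact: le_trans (w1 u). Qed.
Let mw : measurable_fun setT w. Proof. by case: sqw. Qed.
Let W := (fine (\int[N]_u (w u ^+ 2)%:E)).
Let WE : \int[N]_u (w u ^+ 2)%:E = W%:E.
Proof. by case: sqw => _ i; rewrite /W fineK// integrable_fin_num. Qed.

(** [kl_gap] integrated with the weight of the second variable. The second marginal turns the
    integral of [w^2 f] into [W] for every coupling density, whence [2 W]; [e] stays free to balance
    the two terms. Finiteness at the midpoint allows the cancellation in the hypothesis. *)
Lemma entropy_gap f g (a e : R) : K f -> K g -> (0 < e)%R ->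
  ent f + ent g <= a%:E + 2%:E * ent (fun z => (f z + g z) / 2)%R ->
  ent (fun z => (f z + g z) / 2)%R < +oo ->
  \int[P \x N]_z (w z.2 * `|f z - g z|)%:E <= (a / e + e * (2 * W))%:E.
Proof.
move=> kf kg e0 gap midoo; have [mf f0 _ _] := kf; have [mg g0 _ _] := kg.
have := coupling_density_mid kf kg.
set h := (fun z => (f z + g z) / 2)%R in gap midoo *; move=> [mh h0 _ _].
have mE (x : T * U -> R) : measurable_fun setT x -> measurable_fun setT (EFin \o x).
  by move=> ?; exact/measurable_EFinP.
have mkl x : measurable_fun setT x -> measurable_fun setT (fun z : T * U => kl (x z)).
  by move=> mx; exact: measurableT_comp measurable_kl mx.
have mw2 : measurable_fun setT (fun z : T * U => w z.2) by exact: measurableT_comp.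
pose G z := (kl (f z) + kl (g z) - 2 * kl (h z))%R.
have G0 z : (0 <= G z)%R by rewrite subr_ge0 kl_midpoint.
have mG : measurable_fun setT G.
  apply: measurable_funB; first by apply: measurable_funD; exact: mkl.
  by apply: measurable_funM => //; exact: mkl.
have S : \int[P \x N]_z (G z)%:E + 2%:E * ent h = ent f + ent g.
  rewrite -ge0_integralZl_EFin//; last 2 first.
  - by move=> z _; rewrite lee_fin kl_ge0.
  - by apply: mE; exact: mkl.
  rewrite -!ge0_integralD//; try (apply: mE; exact: mkl); try exact: mE;
    try by move=> z _; rewrite lee_fin ?kl_ge0.
  - by apply: eq_integral => z _; rewrite -EFinM -!EFinD /G; congr (_%:E); ring.
  - by move=> z _; rewrite -EFinM lee_fin mulr_ge0// kl_ge0.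
  - by apply: mE; apply: measurable_funM => //; exact: mkl.
have Ga : \int[P \x N]_z (G z)%:E <= a%:E.
  move: gap; rewrite -S leeD2rE//.
  apply: fin_numM => //; rewrite ge0_fin_numE//; apply: integral_ge0 => z _.
  by rewrite lee_fin kl_ge0.
have W2 x : K x -> \int[P \x N]_z (w z.2 ^+ 2 * x z)%:E = W%:E.
  move=> kx; rewrite -WE -(ge0_integral_snd kx (G := fun u => (w u ^+ 2)%:E))//.
  - by apply/measurable_EFinP; exact: measurable_funX.
  - by move=> u; rewrite lee_fin sqr_ge0.
have mwx x : measurable_fun setT x -> measurable_fun setT (fun z : T * U => w z.2 ^+ 2 * x z)%R.
  by move=> mx; apply: measurable_funM => //; exact: measurable_funX.
have wx0 x z : (0 <= x z)%R -> (0 <= w z.2 ^+ 2 * x z :> R)%R.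
  by move=> x0; rewrite mulr_ge0// sqr_ge0.
apply: (@le_trans _ _ (\int[P \x N]_z ((e^-1)%:E * (G z)%:E +
   (e%:E * (w z.2 ^+ 2 * f z)%:E + e%:E * (w z.2 ^+ 2 * g z)%:E)))).
  apply: ge0_le_integral => //.
  - by move=> z _; rewrite lee_fin mulr_ge0.
  - apply: mE; apply: measurable_funM => //; apply: measurableT_comp => //.
    exact: measurable_funB.
  - apply: mE; apply: measurable_funD; first exact: measurable_funM.
    by apply: measurable_funD; apply: measurable_funM => //; exact: mwx.
  - move=> z _; rewrite -!EFinM -!EFinD lee_fin.
    by apply: le_trans (kl_gap (w z.2) (f0 z) (g0 z) e0) _; rewrite /G /h; lra.
have e0' := ltW e0; have ei0 : (0 <= e^-1)%R by rewrite invr_ge0.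
rewrite !ge0_integralD//; try by [move=> z _; rewrite -?EFinM -?EFinD lee_fin
    ?addr_ge0 ?mulr_ge0 ?wx0|apply: mE; apply: measurable_funM => //; exact: mwx
    |apply: mE; apply: measurable_funM]; last first.
  by apply: mE; apply: measurable_funD; apply: measurable_funM => //; exact: mwx.
rewrite !ge0_integralZl_EFin//; try by [move=> z _; rewrite lee_fin ?wx0
  |apply: mE; exact: mwx|exact: mE].
rewrite !W2// -!EFinM -!EFinD.
apply: (@le_trans _ _ ((e^-1)%:E * a%:E + (e * W + e * W)%:E)).
  by rewrite leeD2r// lee_pmul2l// lte_fin invr_gt0.
by rewrite -EFinM -EFinD lee_fin; lra.
Qed.

End entropy_minimizers.

(** * Limits of sequences with summable weighted increments *)

Section fast_convergence.
Context {d1 d2} {T : measurableType d1} {U : measurableType d2} {R : realType}.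
Variables (P : probability T R) (N : probability U R) (w : U -> R).
Hypothesis w1 : forall u, (1 <= w u)%R.
Hypothesis sqw : sq_integrable N w.

Let w0 u : (0 <= w u)%R. Proof. exact: le_trans (w1 u). Qed.

(** The dominant is [f_0] plus the sum of all [|f_{n+1} - f_n|]; where it is finite the telescoping
    series converges absolutely. Its weighted integral is finite because [f_0] contributes the
    integral of [w] and the bounds [C / 2^(n+1)] add up to [C]. *)
Lemma dominated_limit_exists (f_ : (T * U -> R)^nat) (C : R) :
  (forall n, coupling_density P N (f_ n)) -> (0 <= C)%R ->
  (forall n, \int[P \x N]_z (w z.2 * `|f_ n.+1 z - f_ n z|)%:E <=
             (C / (2 ^ n.+1)%:R)%:E) ->
  exists f : T * U -> R, [/\ measurable_fun setT f, forall z, (0 <= f z)%R &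
    dominated_limit P N w f_ f].
Proof.
move=> cf_ C0 dC; have [mw iw2] := sqw.
have mf_ n : measurable_fun setT (f_ n) by have [] := cf_ n.
have f0_ n z : (0 <= f_ n z)%R by have [] := cf_ n.
have mE (x : T * U -> R) : measurable_fun setT x -> measurable_fun setT (EFin \o x).
  by move=> ?; exact/measurable_EFinP.
have mw2 : measurable_fun setT (fun z : T * U => w z.2) by exact: measurableT_comp.
pose df n z := `|f_ n.+1 z - f_ n z|%R.
have mdf n : measurable_fun setT (df n).
  by apply: measurableT_comp => //; exact: measurable_funB.
have dfr0 n z : (0 <= df n z)%R by exact: normr_ge0.
have df0 n z : 0 <= (df n z)%:E by rewrite lee_fin.
pose D z := (f_ 0%N z)%:E + \sum_(0 <= n <oo) (df n z)%:E.
have msum : measurable_fun setT (fun z => \sum_(0 <= n <oo) (df n z)%:E).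
  by apply: ge0_emeasurable_sum => // n _; exact: mE.
have sum0 z : 0 <= \sum_(0 <= n <oo) (df n z)%:E by exact: nneseries_ge0.
have mD : measurable_fun setT D by apply: emeasurable_funD => //; exact: mE.
have fD n z : (f_ n z)%:E <= D z.
  apply: (@le_trans _ _ ((f_ 0%N z)%:E + (\sum_(0 <= i < n) df i z)%:E)).
    rewrite -EFinD lee_fin; elim: n => [|n IH]; first by rewrite big_nil addr0.
    rewrite big_nat_recr//= addrA; apply: (le_trans _ (lerD IH (lexx _))).
    by have := ler_norm (f_ n.+1 z - f_ n z)%R; rewrite /df; lra.
  by rewrite leeD2l// -sumEFin; exact: nneseries_lim_ge.
have cvf z : D z < +oo -> cvgn (f_ ^~ z).
  move=> Dz; rewrite (_ : f_ ^~ z = (fun n => f_ 0%N z + series (telescope (f_ ^~ z)) n)%R).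
    apply: is_cvgD; first exact: is_cvg_cst.
    apply: normed_cvg; apply: nondecreasing_is_cvgn.
      by apply: nondecreasing_series => n _ _; exact: normr_ge0.
    have Sfin : \sum_(0 <= n <oo) (df n z)%:E \is a fin_num.
      rewrite ge0_fin_numE//; apply: le_lt_trans Dz.
      by rewrite leeDr// lee_fin.
    exists (fine (\sum_(0 <= n <oo) (df n z)%:E)) => _ [n _ <-].
    rewrite -lee_fin fineK// /series/= -sumEFin.
    exact: (@nneseries_lim_ge _ (fun n => (df n z)%:E) xpredT).
  by apply/funext => n; rewrite -eq_sum_telescope.
(* The lower limit is measurable and nonnegative everywhere, also where the sequence diverges. *)
pose f z := fine (limn_einf (fun n => (f_ n z)%:E)).
exists f; split.
- apply: measurableT_comp => //; apply: measurable_fun_limn_einf => n; exact: mE.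
- by move=> z; apply: fine_ge0; apply: limn_einf_ge0 => n; rewrite lee_fin.
exists D; split => //.
- by move=> z; rewrite adde_ge0// lee_fin.
- rewrite (eq_integral (fun z => (w z.2 * f_ 0%N z)%:E +
      \sum_(0 <= n <oo) (w z.2 * df n z)%:E)); last first.
    move=> z _; rewrite ge0_muleDr ?lee_fin// EFinM; congr (_ + _).
    by rewrite -nneseriesZl//; apply: eq_eseriesr => n _; rewrite EFinM.
  rewrite ge0_integralD//; last 4 first.
  + by move=> z _; rewrite lee_fin mulr_ge0.
  + by apply: mE; exact: measurable_funM.
  + by move=> z _; apply: nneseries_ge0 => n _ _; rewrite lee_fin mulr_ge0.
  + apply: ge0_emeasurable_sum; first by move=> n z _ _; rewrite lee_fin mulr_ge0.
    by move=> n _; apply: mE; exact: measurable_funM.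
  apply: lte_add_pinfty.
    rewrite (ge0_integral_snd (cf_ 0%N) (G := fun u => (w u)%:E))//.
    + exact: integrable_lty (sq_integrable_integrable sqw).
    + exact/measurable_EFinP.
  rewrite integral_nneseries//; last 2 first.
  + by move=> n; apply: mE; exact: measurable_funM.
  + by move=> n z _; rewrite lee_fin mulr_ge0.
  apply: (@le_lt_trans _ _ C%:E); last exact: ltry.
  apply: le_trans (epsilon_trick0 xpredT C0).
  apply: lee_nneseries => [n _ _|n _]; last exact: dC.
  by apply: integral_ge0 => z _; rewrite lee_fin mulr_ge0.
- move=> z Dz; have /cvg_ex[l fl] := cvf z Dz.
  suff -> : f z = l by [].
  have : (f_ n z)%:E @[n --> \oo] --> l%:E by apply: cvg_EFin => //; near=> n.
  by move/cvg_limn_einf_sup => -[h _]; rewrite /f h.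
Unshelve. all: by end_near. Qed.

End fast_convergence.

Section penalized_entropy.
Context {d1 d2} {T : measurableType d1} {U : measurableType d2} {R : realType}.
Implicit Types (f g : T * U -> R).
Variables (P : probability T R) (N : probability U R) (w : U -> R).
Hypothesis w1 : forall u, (1 <= w u)%R.
Hypothesis sqw : sq_integrable N w.
Local Notation K := (coupling_density P N).
Local Notation ent f := (\int[P \x N]_z (kl (f z))%:E).

(** The infima of [ent + q n] increase in [n] to some [V <= b]. Almost minimizers taken along
    growing indices are compared at a common index through their midpoint; the resulting limit
    satisfies the bound for every [n] at once. *)
Lemma penalized_entropy_limit (q : nat -> (T * U -> R) -> \bar R) (b : R) :
  (forall n f, 0 <= q n f) ->
  (forall n m f, (n <= m)%N -> q n f <= q m f) ->
  (forall n f g, K f -> K g ->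
    2%:E * q n (fun z => (f z + g z) / 2)%R <= q n f + q n g) ->
  (forall n (f_ : (T * U -> R)^nat) f, (forall k, K (f_ k)) -> K f -> dominated_limit P N w f_ f ->
    q n f <= limn_einf (fun k => q n (f_ k))) ->
  (forall n (e : R), (0 < e)%R -> exists2 f, K f & ent f + q n f <= (b + e)%:E) ->
  exists2 f, K f & forall n, ent f + q n f <= b%:E.
Proof.
move=> q0 qnd qmid qlsc Jb.
pose J n f := ent f + q n f.
have ent0 f : K f -> 0 <= ent f.
  by move=> [_ f0 _ _]; apply: integral_ge0 => z _; rewrite lee_fin kl_ge0.
have le_fin (x : \bar R) (r : R) : 0 <= x -> x <= r%:E -> x \is a fin_num.
  by move=> x0 xr; rewrite ge0_fin_numE// (le_lt_trans xr)// ltry.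
pose v n := ereal_inf [set J n f | f in K].
have v0 n : 0 <= v n.
  by apply: le_ereal_inf_tmp => _ [f kf <-]; rewrite adde_ge0// ent0.
have vb n : v n <= b%:E.
  apply/lee_addgt0Pr => e e0; have [f kf Jf] := Jb n e e0.
  by rewrite -EFinD (le_trans _ Jf)//; apply: ereal_inf_lbound; exists f.
have vfin n : v n \is a fin_num by exact: le_fin (v0 n) (vb n).
pose V := sup (range (fine \o v)).
have hV : has_sup (range (fine \o v)).
  split; first by exists (fine (v 0%N)); exists 0%N.
  by exists b => _ [n _ <-] /=; rewrite -lee_fin fineK.
have Vb : (V <= b)%R.
  by apply: ge_sup; [exact: hV.1|move=> _ [n _ <-] /=; rewrite -lee_fin fineK].
have vV n : (fine (v n) <= V)%R by apply: ub_le_sup; [exact: hV.2|exists n].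
have vnd n m : (n <= m)%N -> (fine (v n) <= fine (v m))%R.
  move=> nm; rewrite fine_le//; apply: le_ereal_inf_tmp => _ [f kf <-].
  apply: (@le_trans _ _ (J n f)); first by apply: ereal_inf_lbound; exists f.
  by rewrite leeD2l// qnd.
pose e k : R := ((2 ^ k)%:R^-1)%R.
have e0 k : (0 < e k)%R by rewrite invr_gt0 ltr0n expn_gt0.
have e2 k : (0 < e k ^+ 2)%R by rewrite exprn_gt0.
have eS k : (e k.+1 <= e k)%R.
  by rewrite lef_pV2 ?posrE ?ltr0n ?expn_gt0// ler_nat leq_exp2l.
have eS2 k : (e k.+1 ^+ 2 <= e k ^+ 2)%R.
  by have := eS k; have := e0 k; have := e0 k.+1; nra.
(* The index is at least [k] and large enough for its infimum to be within [e k ^+ 2] of [V]; the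
   density then exceeds [V] by at most the same amount. *)
have /choice[p pP] : forall k, exists p : nat * (T * U -> R),
    [/\ K p.2, (k <= p.1)%N, (V - e k ^+ 2 <= fine (v p.1))%R &
        J p.1 p.2 <= (V + e k ^+ 2)%:E].
  move=> k; have [_ [n _ <-] /= Vn] := sup_adherent (e2 k) hV.
  have : v (maxn k n) < (V + e k ^+ 2)%:E.
    rewrite -(fineK (vfin _)) lte_fin; apply: le_lt_trans (vV _) _.
    by rewrite ltrDl.
  move=> /ereal_inf_lt[_ [f kf <-] Jf].
  exists (maxn k n, f); split => //=; first exact: leq_maxl.
  - by apply: (le_trans (ltW Vn)); apply: vnd; exact: leq_maxr.
  - exact: ltW.
pose f_ k := (p k).2.
have kf_ k : K (f_ k) by have [] := pP k.
have Jn n k : (n <= (p k).1)%N -> J n (f_ k) <= (V + e k ^+ 2)%:E.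
  move=> nk; have [_ _ _] := pP k; apply: le_trans.
  by rewrite leeD2l// qnd.
pose W := fine (\int[N]_u (w u ^+ 2)%:E).
have W0 : (0 <= W)%R.
  by apply/fine_ge0/integral_ge0 => u _; rewrite lee_fin sqr_ge0.
have step k : \int[P \x N]_z (w z.2 * `|f_ k.+1 z - f_ k z|)%:E <=
    ((8 + 4 * W) / (2 ^ k.+1)%:R)%:E.
  (* At the smaller index both densities keep their upper bounds, by monotonicity of [q], and the
     infimum still exceeds [V - e k ^+ 2]. *)
  pose n := minn (p k).1 (p k.+1).1.
  have Jf : J n (f_ k) <= (V + e k ^+ 2)%:E by apply: Jn; exact: geq_minl.
  have Jg : J n (f_ k.+1) <= (V + e k ^+ 2)%:E.
    apply: (le_trans (Jn _ _ _)); first exact: geq_minr.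
    by rewrite lee_fin lerD2l.
  have Vn : (V - e k ^+ 2 <= fine (v n))%R.
    have [_ _ h1 _] := pP k; have [_ _ h2 _] := pP k.+1; have := eS2 k.
    by rewrite /n /minn; case: ifP => _; lra.
  have kh := coupling_density_mid (kf_ k.+1) (kf_ k).
  have qh := qmid n _ _ (kf_ k.+1) (kf_ k).
  have eh : ent (fun z => (f_ k.+1 z + f_ k z) / 2)%R <=
      (1 - 2^-1)%:E * ent (f_ k.+1) + 2^-1%:E * ent (f_ k).
    have := @entropy_convex _ _ _ _ _ P N (f_ k.+1) (f_ k) (2^-1)%R (kf_ k.+1) (kf_ k).
    have E z : ((1 - 2^-1) * f_ k.+1 z + 2^-1 * f_ k z =
        (f_ k.+1 z + f_ k z) / 2)%R by field.
    under [X in (_ -> X <= _) -> _]eq_integral do rewrite E.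
    by apply; apply/andP; split; lra.
  set h := (fun z => (f_ k.+1 z + f_ k z) / 2)%R in kh qh eh.
  have vh : v n <= J n h by apply: ereal_inf_lbound; exists h.
  (* Two values at most [V + e k ^+ 2] and a midpoint value at least [V - e k ^+ 2] leave a gap of
     [4 * e k ^+ 2]. Taking [e k] as the free parameter makes both terms of order [e k]: the sum is
     [(4 + 2 W) e k = (8 + 4 W) / 2^(k+1)]. *)
  have : \int[P \x N]_z (w z.2 * `|f_ k.+1 z - f_ k z|)%:E <=
      (4 * e k ^+ 2 / e k + e k * (2 * W))%:E.
    have [f1 f2] : ent (f_ k) \is a fin_num /\ q n (f_ k) \is a fin_num.
      by split; apply: (le_fin _ (V + e k ^+ 2)%R); rewrite ?ent0//;
        apply: le_trans Jf; rewrite /J ?leeDl ?leeDr ?ent0.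
    have [g1 g2] : ent (f_ k.+1) \is a fin_num /\ q n (f_ k.+1) \is a fin_num.
      by split; apply: (le_fin _ (V + e k ^+ 2)%R); rewrite ?ent0//;
        apply: le_trans Jg; rewrite /J ?leeDl ?leeDr ?ent0.
    have h1 : ent h \is a fin_num.
      move: eh; rewrite -(fineK f1) -(fineK g1) -!EFinM -EFinD.
      by move/le_fin; apply; exact: ent0.
    have h2 : q n h \is a fin_num.
      move: qh; rewrite -(fineK f2) -(fineK g2) -EFinD => qh.
      apply: (le_fin _ (fine (q n (f_ k.+1)) + fine (q n (f_ k)))%R) => //.
      by apply: le_trans qh; rewrite lee_pemull// lee_fin ler1n.
    apply: (entropy_gap w1 sqw (kf_ k.+1) (kf_ k)) => //; last first.
      by rewrite -ge0_fin_numE// ent0.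
    move: Jf Jg qh vh; rewrite /J -/h -(fineK f1) -(fineK f2) -(fineK g1).
    rewrite -(fineK g2) -(fineK h1) -(fineK h2) -(fineK (vfin n)).
    by rewrite -?EFinM -?EFinD !lee_fin; lra.
  move=> /le_trans; apply; rewrite lee_fin le_eqVlt; apply/orP; left; apply/eqP.
  have ek := e0 k; rewrite expnS natrM invfM -/(e k).
  by field; rewrite gt_eqF.
have C0 : (0 <= 8 + 4 * W :> R)%R by rewrite addr_ge0// mulr_ge0.
have [f [mf f0 lf]] := dominated_limit_exists w1 sqw kf_ C0 step.
have [mw _] := sqw.
have kf : K f by exact: coupling_density_limit lf.
exists f => // n; apply: (@le_trans _ _ V%:E); last by rewrite lee_fin.
have entl : ent f <= limn_einf (fun k => ent (f_ k)) by exact: entropy_lsc lf.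
apply: (le_trans (leeD entl (qlsc n _ _ kf_ kf lf))).
apply: (le_trans (ge0_limn_einfD _ _)) => //; first by move=> k; exact: ent0.
have cV : (V + e k ^+ 2)%:E @[k --> \oo] --> V%:E.
  rewrite -[X in _ --> X%:E]addr0; apply: cvg_EFin; first by near=> k.
  apply: cvgD; first exact: cvg_cst.
  have ce : e k @[k --> \oo] --> (0 : R)%R.
    rewrite (_ : e = geometric 1%R (2^-1)%R).
      by apply: cvg_geometric; rewrite ger0_norm ?invr_ge0// invf_lt1 ?ltr1n.
    by apply/funext => k; rewrite /e /geometric/= mul1r exprVn natrX.
  by rewrite -[X in _ --> X](mulr0 (0 : R)%R); under eq_fun do rewrite expr2; exact: cvgM.
rewrite -(cvg_limn_einf_sup cV).1; apply: le_limn_einf.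
(* From [k = n] on, the index of [f_ k] is at least [n], so its bound also holds with [q n]. *)
near=> k; apply: Jn; have [_ kp _ _] := pP k; apply: leq_trans kp.
by near: k; exact: nbhs_infty_ge.
Unshelve. all: by end_near. Qed.

End penalized_entropy.

Lemma cvg_sum_fin {R : realType} {I : finType} (u : I -> R^nat) (l : I -> R) :
  (forall i, u i @ \oo --> l i) ->
  (fun n => \sum_i u i n)%R @ \oo --> (\sum_i l i)%R.
Proof.
move=> ul; elim: (index_enum _) => [|i s IH].
  by under eq_fun do rewrite big_nil; rewrite big_nil; exact: cvg_cst.
by under eq_fun do rewrite big_cons; rewrite big_cons; exact: cvgD.
Qed.

(** * The quadratic penalty on barycenters *)

Section quadratic_penalty.
Context {disp} {T : measurableType disp} {R : realType} {d : nat}.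
Variables (P : probability T R) (nu : probability (Rd R d) R).
Hypothesis nu2 : P2 nu.
Local Notation U := (Rd R d).
Implicit Types (f g : T * U -> R).
Local Notation K := (coupling_density P nu).
Local Notation ent f := (\int[P \x nu]_z (kl (f z))%:E).

Definition coordv (i : 'I_d) (y : U) : R := (y : 'rV[R]_d) ord0 i.

Definition weight (y : U) : R := Num.sqrt (1 + dotv y y).

Let dot0 (y : U) : (0 <= dotv y y)%R := dotv_ge0 y.

Let mdot : measurable_fun [set: U] (fun y => dotv y y).
Proof. exact: measurable_dotv. Qed.

Lemma integrable_dotv : nu.-integrable setT (fun y => (dotv y y)%:E).
Proof.
apply/integrableP; split; first exact/measurable_EFinP.
by under eq_integral do rewrite gee0_abs ?lee_fin//.
Qed.

Lemma weight_ge1 y : (1 <= weight y)%R.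
Proof. by rewrite -[leLHS]sqrtr1 ler_sqrt ?lerDl// addr_ge0. Qed.

Lemma sq_integrable_weight : sq_integrable nu weight.
Proof.
split.
  apply: (measurableT_comp (continuous_measurable_fun (@sqrt_continuous R))).
  exact: measurable_funD.
have := integrableD measurableT (finite_measure_integrable_cst nu 1 measurableT)
  integrable_dotv.
by apply: eq_integrable => // y _; rewrite sqr_sqrtr// addr_ge0.
Qed.

Lemma sq_integrable_coord i : sq_integrable nu (coordv i).
Proof.
have := @sq_integrable_le _ _ _ nu (coordv i) (fun y => (dotv y y)%:E); apply.
- exact: measurable_coord.
- exact/measurable_EFinP.
- by move=> y; rewrite lee_fin.
- exact: integrable_lty integrable_dotv.
- by apply: aeW => y; rewrite lee_fin; exact: sqr_coord_le_dotv.
Qed.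

Lemma coord_le_weight i y : (`|coordv i y| <= weight y)%R.
Proof.
rewrite -sqrtr_sqr ler_sqrt ?addr_ge0//.
by apply: (le_trans (sqr_coord_le_dotv y i)); rewrite lerDr.
Qed.

Let icoord i : nu.-integrable setT (EFin \o coordv i).
Proof. exact: sq_integrable_integrable (sq_integrable_coord i). Qed.

Definition baryc f (i : 'I_d) : T -> R := bary nu (coordv i) f.

(** Only almost everywhere: linearity of [bary] requires both slices to be integrable. *)
Lemma baryc_convex f g (s : R) : K f -> K g ->
  {ae P, forall t, forall i, baryc (fun z => (1 - s) * f z + s * g z)%R i t =
    ((1 - s) * baryc f i t + s * baryc g i t)%R}.
Proof.
move=> kf kg; apply: filter_forall => i.
have jf := ae_integrable_bary kf (icoord i).
have jg := ae_integrable_bary kg (icoord i).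
apply: filter_app jf; apply: filter_app jg; apply: aeW => t jg jf.
have jf' := integrableZl measurableT (1 - s)%R jf.
have jg' := integrableZl measurableT s jg.
apply: EFin_inj; rewrite EFinD !EFinM -(baryE jf) -(baryE jg).
have E u : (coordv i u * ((1 - s) * f (t, u) + s * g (t, u)))%:E =
    (1 - s)%:E * (coordv i u * f (t, u))%:E + s%:E * (coordv i u * g (t, u))%:E.
  by rewrite -!EFinM -EFinD; congr (_%:E); ring.
rewrite -baryE; last first.
  by apply: (eq_integrable _ _ _ _ (integrableD measurableT jf' jg')) => // u _; rewrite E.
by rewrite (eq_integral _ _ (fun u _ => E u)) integralD// !integralZl.
Qed.

Variable x : 'I_d -> T -> R.
Hypothesis sqx : forall i, sq_integrable P (x i).

Definition penalty f : \bar R :=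
  \int[P]_t (\sum_i (x i t - baryc f i t) ^+ 2)%:E.

Lemma measurable_baryc f i : K f -> measurable_fun setT (baryc f i).
Proof. by move=> kf; exact: (measurable_bary kf (icoord i)). Qed.

Let mx i : measurable_fun setT (x i). Proof. by case: (sqx i). Qed.

Lemma measurable_penalty f : K f ->
  measurable_fun setT (fun t => \sum_i (x i t - baryc f i t) ^+ 2)%R.
Proof.
move=> kf; apply: measurable_sum => i; apply: measurable_funX.
by apply: measurable_funB => //; exact: measurable_baryc.
Qed.

Lemma penalty_ge0 f : 0 <= penalty f.
Proof. by apply: integral_ge0 => t _; rewrite lee_fin sumr_ge0// => i _; rewrite sqr_ge0. Qed.

Lemma penalty_mid f g : K f -> K g ->
  2%:E * penalty (fun z => (f z + g z) / 2)%R <= penalty f + penalty g.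
Proof.
move=> kf kg; have kh := coupling_density_mid kf kg.
have E : (fun z => (1 - 2^-1) * f z + 2^-1 * g z)%R = (fun z => (f z + g z) / 2)%R.
  by apply/funext => z; field.
have mE h : K h -> measurable_fun setT (fun t => (\sum_i (x i t - baryc h i t) ^+ 2)%:E).
  by move=> kh'; apply/measurable_EFinP; exact: measurable_penalty.
have p0 h t : 0 <= (\sum_i (x i t - baryc h i t) ^+ 2)%:E.
  by rewrite lee_fin sumr_ge0// => i _; rewrite sqr_ge0.
rewrite /penalty -ge0_integralD//; try exact: mE.
rewrite -ge0_integralZl_EFin//; try exact: mE.
apply: ae_ge0_le_integral => //.
- by move=> t _; rewrite mule_ge0// lee_fin.
- by apply: emeasurable_funM => //; exact: mE.
- by move=> t _; rewrite adde_ge0.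
- by apply: emeasurable_funD; exact: mE.
have := baryc_convex 2^-1%R kf kg; rewrite E; apply: filter_app; apply: aeW.
move=> t Bt _; rewrite -EFinM -EFinD lee_fin -big_split/= mulr_sumr.
apply: ler_sum => i _; rewrite Bt.
have := sqr_ge0 (baryc f i t - baryc g i t)%R.
set a := baryc f i t; set b := baryc g i t.
have -> : ((1 - 2^-1) * a + 2^-1 * b = (a + b) / 2)%R by field.
by nra.
Qed.

Lemma penalty_lsc (f_ : (T * U -> R)^nat) f :
  (forall k, K (f_ k)) -> K f -> dominated_limit P nu weight f_ f ->
  penalty f <= limn_einf (fun k => penalty (f_ k)).
Proof.
move=> kf_ kf lf; have [mf f0 _ _] := kf.
have mE h : K h -> measurable_fun setT (fun t => (\sum_i (x i t - baryc h i t) ^+ 2)%:E).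
  by move=> kh'; apply/measurable_EFinP; exact: measurable_penalty.
have p0 h t : 0 <= (\sum_i (x i t - baryc h i t) ^+ 2)%:E.
  by rewrite lee_fin sumr_ge0// => i _; rewrite sqr_ge0.
have [mw _] := sq_integrable_weight.
apply: le_trans (fatou P measurableT (fun k => mE _ (kf_ k)) (fun k t _ => p0 _ t)).
apply: ae_ge0_le_integral => //.
- exact: mE.
- by move=> t _; exact: limn_einf_ge0.
- by apply: measurable_fun_limn_einf => k; exact: mE.
have : {ae P, forall t, forall i, baryc (f_ n) i t @[n --> \oo] --> baryc f i t}.
  apply: filter_forall => i.
  have := cvg_bary mw weight_ge1 kf_ mf lf (@measurable_coord _ _ i) (coord_le_weight i).
  by apply: filter_app; apply: aeW => t [it]; rewrite (baryE it) => /fine_cvg.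
apply: filter_app; apply: aeW => t Bt _.
have : (\sum_i (x i t - baryc (f_ n) i t) ^+ 2)%:E @[n --> \oo] -->
    (\sum_i (x i t - baryc f i t) ^+ 2)%:E.
  apply: cvg_EFin; first by near=> n.
  apply: cvg_sum_fin => i; have : (x i t - baryc (f_ n) i t)%R @[n --> \oo] -->
    (x i t - baryc f i t)%R by apply: cvgB; [exact: cvg_cst|exact: Bt].
  by move=> c; under eq_fun do rewrite expr2; rewrite expr2; exact: cvgM.
by move/cvg_limn_einf_sup => -[-> _].
Unshelve. all: by end_near. Qed.

End quadratic_penalty.

(** * Dual variables from first-order optimality *)

Section penalized_duality.
Context {disp} {T : measurableType disp} {R : realType} {d : nat}.
Variables (P : probability T R) (nu : probability (Rd R d) R).
Hypothesis nu2 : P2 nu.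
Variable x : 'I_d -> T -> R.
Hypothesis sqx : forall i, sq_integrable P (x i).
Local Notation U := (Rd R d).
Implicit Types (f g : T * U -> R) (a b : 'I_d -> T -> R).
Local Notation K := (coupling_density P nu).
Local Notation ent f := (\int[P \x nu]_z (kl (f z))%:E).
Local Notation B := (baryc nu).

Lemma first_order_ge0 (a b : R) :
  (forall s, 0 < s -> s <= 1 -> 0 <= a + s * b)%R -> (0 <= a)%R.
Proof.
move=> h; rewrite leNgt; apply/negP => a0.
have b0 : (0 < b)%R by have := h 1%R ltr01 (lexx _); lra.
(* At this [s] the expression is at most [a / 2], which is negative. *)
have := h (Num.min 1 (- a / (2 * b)))%R.
rewrite lt_min ltr01 divr_gt0 ?mulr_gt0 ?oppr_gt0// ge_min lexx => /(_ isT isT).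
have : (Num.min 1 (- a / (2 * b)) * b <= - a / (2 * b) * b)%R.
  by rewrite ler_pM2r// ge_min lexx orbT.
have -> : (- a / (2 * b) * b = - a / 2)%R by field; rewrite gt_eqF.
by lra.
Qed.

Let dot a b t := (\sum_i a i t * b i t)%R.

Lemma integrable_dot a b :
  (forall i, sq_integrable P (a i)) -> (forall i, sq_integrable P (b i)) ->
  P.-integrable setT (EFin \o dot a b).
Proof.
move=> ia ib; have := integrable_sum measurableT (index_enum 'I_d)
  (fun i (_ : true) => sq_integrableM (ia i) (ib i)).
by apply: eq_integrable => // t _; rewrite /= sumEFin.
Qed.

Lemma coupling_density_cst1 : K (cst 1%R).
Proof.
by split=> //; apply: aeW => t; exact: (integral_prob_cst _ 1).
Qed.

Lemma sq_integrable_baryc f i : K f -> sq_integrable P (B f i).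
Proof. by move=> kf; exact: (sq_integrable_bary kf (sq_integrable_coord nu2 i)). Qed.

(* First-order optimality of a minimizer [f] of [ent + c * penalty]: its scaled
   barycenter defect [2 c (x - B f)] is the dual variable. *)
Lemma penalized_dual (c : R) : (0 <= c)%R ->
  exists (r : 'I_d -> T -> R) (v : R), [/\ forall i, sq_integrable P (r i),
    exists2 f, K f & ent f + c%:E * penalty P nu x f <= v%:E &
    forall f, K f -> v%:E <= ent f - \int[P]_t (\sum_i r i t * B f i t)%:E +
                             \int[P]_t (\sum_i r i t * x i t)%:E].
Proof.
move=> c0; pose J f := ent f + c%:E * penalty P nu x f.
have ent0 f : K f -> 0 <= ent f.
  by move=> [_ f0 _ _]; apply: integral_ge0 => z _; rewrite lee_fin kl_ge0.
have pen0 f : 0 <= c%:E * penalty P nu x f.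
  by rewrite mule_ge0 ?lee_fin ?penalty_ge0.
have sqd f i : K f -> sq_integrable P (fun t => x i t - B f i t)%R.
  by move=> kf; apply: sq_integrableB => //; exact: sq_integrable_baryc.
have penE f : K f -> let r := fun i t => (x i t - B f i t)%R in
    penalty P nu x f = (\int[P]_t dot r r t)%R%:E.
  move=> kf r; rewrite /Rintegral fineK; last first.
    by apply: integrable_fin_num => //; apply: integrable_dot => i; exact: sqd.
  by apply: eq_integral => t _; congr (_%:E); apply: eq_bigr => i _; rewrite expr2.
(* The product coupling has density [1], no entropy and a finite penalty, so the infimum below is
   finite. *)
have entc : ent (cst 1%R) = 0 by apply: integral0_eq => z _; rewrite /= kl1.
pose b := ereal_inf [set J f | f in K].
have b0 : 0 <= b.
  by apply: le_ereal_inf_tmp => _ [f kf <-]; rewrite adde_ge0// ent0.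
have k1 := coupling_density_cst1.
have bfin : b \is a fin_num.
  rewrite ge0_fin_numE//; apply: (@le_lt_trans _ _ (J (cst 1%R))).
    by apply: ereal_inf_lbound; exists (cst 1%R).
  by rewrite /J entc add0e penE// -EFinM ltry.
(* A family of penalties constant in [n], with [b] the infimum itself: the limit is a minimizer. *)
have [|||||f kf Jf] := @penalized_entropy_limit _ _ _ _ _ P nu (@weight R d)
    (@weight_ge1 R d) (sq_integrable_weight nu2)
    (fun=> fun f => c%:E * penalty P nu x f) (fine b).
- by move=> n f; exact: pen0.
- by [].
- move=> n f g kf kg; rewrite muleCA -ge0_muleDr ?penalty_ge0//.
  by rewrite lee_wpmul2l ?lee_fin// penalty_mid.
- move=> n f_ f kf_ kf lf; have := penalty_lsc nu2 sqx kf_ kf lf.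
  by move=> h; apply: le_trans (limn_einfZl _ c0); rewrite lee_wpmul2l ?lee_fin.
- move=> n e e0; have : b < b + e%:E by rewrite -(fineK bfin) -EFinD lte_fin ltrDl.
  move=> /ereal_inf_lt[_ [f kf <-] Jf]; exists f => //.
  by rewrite EFinD fineK// ltW.
move: {Jf}(Jf 0%N) => Jf.
pose r i t := (x i t - B f i t)%R.
have sqr i : sq_integrable P (r i) by exact: sqd.
pose e0 := fine (ent f); pose p0 := (\int[P]_t dot r r t)%R.
have p00 : (0 <= p0)%R.
  by apply: Rintegral_ge0 => t _; apply: sumr_ge0 => i _; rewrite -expr2 sqr_ge0.
have e0E : ent f = e0%:E.
  rewrite fineK// ge0_fin_numE ?ent0//; apply: le_lt_trans (ltry (fine b)).
  by apply: le_trans Jf; rewrite leeDl.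
have bv : (fine b)%:E = (e0 + c * p0)%:E.
  apply/eqP; rewrite eq_le; apply/andP; split; last first.
    by move: Jf; rewrite e0E penE.
  rewrite fineK//; apply: ereal_inf_lbound; exists f => //.
  by rewrite /J e0E penE.
pose dr i t := (2 * c * r i t)%R.
exists dr, (fine b); split=> //.
- by move=> i; exact: sq_integrableZ.
- by exists f.
move=> g kg; have sqg i := sq_integrable_baryc i kg.
have sqdr i : sq_integrable P (dr i) by exact: sq_integrableZ.
pose s i t := (B g i t - B f i t)%R.
have sqs i : sq_integrable P (s i) by apply: sq_integrableB => //; exact: sq_integrable_baryc.
pose p1 := (\int[P]_t dot r s t)%R; pose p2 := (\int[P]_t dot s s t)%R.
have RE a b' : (forall i, sq_integrable P (a i)) -> (forall i, sq_integrable P (b' i)) ->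
    \int[P]_t (dot a b' t)%:E = (\int[P]_t dot a b' t)%R%:E.
  by move=> ia ib; rewrite /Rintegral fineK// integrable_fin_num//; exact: integrable_dot.
rewrite (RE dr (B g))// (RE dr x)//.
(* [x - B g = r - s], where [s] is the change of barycenter from [f] to [g]. *)
have pairE : (\int[P]_t dot dr x t - \int[P]_t dot dr (B g) t = 2 * c * p0 - 2 * c * p1)%R.
  rewrite -RintegralB//; try exact: integrable_dot.
  rewrite /p0 /p1 -!RintegralZl//; try exact: integrable_dot.
  rewrite -RintegralB//; try exact: integrable_dot; last 2 first.
  - by have := integrableZl measurableT (2 * c)%R (integrable_dot sqr sqr).
  - by have := integrableZl measurableT (2 * c)%R (integrable_dot sqr sqs).
  apply: eq_Rintegral => t _; rewrite /dot !mulr_sumr -!sumrB; apply: eq_bigr => i _.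
  by rewrite /dr /r /s; ring.
have [eg|] := ltP (ent g) +oo; last first.
  by rewrite leye_eq => /eqP ->; rewrite addye// leey.
pose e1 := fine (ent g).
have e1E : ent g = e1%:E by rewrite fineK// ge0_fin_numE ?ent0.
rewrite bv e1E -EFinB -EFinD lee_fin.
(* The dual functional contains [2 c p0] where the minimum has only [c p0]; the surplus is
   nonnegative. *)
suff : (0 <= e1 - e0 - 2 * c * p1)%R.
  by move: pairE; have := mulr_ge0 c0 p00; lra.
(* Minimality along the segment from [f] to [g], divided by [t]: convexity bounds the entropy
   linearly in [t], and the penalty is exactly quadratic with second-order term [t^2 p2]. *)
apply: (@first_order_ge0 _ (c * p2)%R) => t t0 t1.
have t01 : (0 <= t <= 1)%R by rewrite ltW.
pose h z := ((1 - t) * f z + t * g z)%R.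
have kh : K h by exact: coupling_density_convex.
have penh : penalty P nu x h = (p0 - 2 * t * p1 + t ^+ 2 * p2)%:E.
  rewrite penE//; congr (_%:E).
  rewrite /p0 /p1 /p2 -!RintegralZl//; try exact: integrable_dot.
  have i1 := integrableZl measurableT (2 * t)%R (integrable_dot sqr sqs).
  have i2 := integrableZl measurableT (t ^+ 2)%R (integrable_dot sqs sqs).
  have i0 := integrable_dot sqr sqr.
  rewrite -RintegralB// -RintegralD//; last exact: (integrableB measurableT i0 i1).
  congr fine; apply: ae_eq_integral => //.
  - apply: measurable_int (integrable_dot _ _) => i; exact: sqd.
  - exact: measurable_int (integrableD measurableT (integrableB measurableT i0 i1) i2).
  have := baryc_convex nu2 t kf kg; apply: filter_app; apply: aeW => u Bu _.
  congr (_%:E); rewrite /dot !mulr_sumr -sumrB -big_split/=; apply: eq_bigr => i _.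
  by rewrite Bu /r /s; ring.
have : (fine b)%:E <= J h by rewrite fineK//; apply: ereal_inf_lbound; exists h.
have enth : ent h <= ((1 - t) * e0 + t * e1)%:E.
  by apply: le_trans (entropy_convex kf kg t01) _; rewrite e0E e1E.
rewrite bv /J penh => /le_trans/(_ (leeD2r _ enth)).
rewrite -EFinM -EFinD lee_fin => key.
by rewrite -(pmulr_rge0 _ t0); lra.
Qed.

End penalized_duality.

(** * Martingale couplings and their densities *)

Section disintegration.
Context {d1 d2} {X : measurableType d1} {Y : measurableType d2} {R : realType}.
Variables (mu : probability X R) (k : R.-pker X ~> Y).
Variable (m : probability (X * Y)%type R).
Hypothesis mE : forall C, measurable C -> m C = \int[mu]_x k x (xsection C x).

Import HBNNSimple.

Let mk C : measurable C -> measurable_fun setT (fun x => k x (xsection C x)).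
Proof. by move=> mC; apply: measurable_fun_xsection_finite_kernel; rewrite inE. Qed.

Let int_indic x C : measurable C ->
  \int[k x]_y (\1_C (x, y))%:E = k x (xsection C x).
Proof.
move=> mC; rewrite -(setIT (xsection C x)) -integral_indic//; last first.
  exact: measurable_xsection.
by apply: eq_integral => y _; rewrite !indicE mem_xsection.
Qed.

Let sec (f : {nnsfun (X * Y)%type >-> R}) x : \int[k x]_y (f (x, y))%:E =
  \sum_(r \in range f) r%:E * k x (xsection (f @^-1` [set r]) x).
Proof.
have mf r : measurable (f @^-1` [set r]) by exact: measurable_funPTI.
under eq_integral do rewrite fimfunE -fsumEFin//.
have mind r : measurable_fun setT (fun y => \1_(f @^-1` [set r]) (x, y) : R).
  by apply: measurableT_comp (pair1_measurable x); exact: measurable_indic.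
rewrite ge0_integral_fsum//; last 2 first.
- by move=> r; apply/measurable_EFinP; exact: measurable_funM.
- by move=> r y _; rewrite EFinM nnfun_muleindic_ge0.
apply: eq_fsbigr => r; rewrite inE => -[z _ <-].
under eq_integral do rewrite EFinM.
rewrite ge0_integralZl_EFin//; first by rewrite int_indic.
exact/measurable_EFinP.
Qed.

Let integral_nnsfun (f : {nnsfun (X * Y)%type >-> R}) :
  \int[m]_z (f z)%:E = \int[mu]_x \int[k x]_y (f (x, y))%:E.
Proof.
have mf r : measurable (f @^-1` [set r]) by exact: measurable_funPTI.
rewrite integralT_nnsfun sintegralE; under [RHS]eq_integral do rewrite sec.
rewrite ge0_integral_fsum//; last 2 first.
- by move=> r; apply: measurable_funeM; exact: mk.
- move=> r x _; have [r0|r0] := leP 0%R r; first by rewrite mule_ge0 ?lee_fin.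
  by rewrite preimage_nnfun0// xsection0 measure0 mule0.
apply: eq_fsbigr => r; rewrite inE => -[z _ <-].
rewrite ge0_integralZl_EFin//; [|exact: mk].
congr (_ * _); exact: mE.
Qed.

Lemma ge0_integral_disintegration (g : X * Y -> \bar R) :
  measurable_fun setT g -> (forall z, 0 <= g z) ->
  \int[m]_z g z = \int[mu]_x \int[k x]_y g (x, y).
Proof.
move=> mg g0; pose g_ := nnsfun_approx measurableT mg.
have mg_ n : measurable_fun setT (fun z => (g_ n z)%:E) by exact/measurable_EFinP.
have mg_x n x : measurable_fun setT (fun y => (g_ n (x, y))%:E).
  exact: measurableT_comp (mg_ n) (pair1_measurable x).
have nd_ z : {homo (fun n => (g_ n z)%:E) : a b / (a <= b)%N >-> a <= b}.
  by move=> a b ab; rewrite lee_fin; exact/lefP/nd_nnsfun_approx.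
have lim_ z : lim ((g_ n z)%:E @[n --> \oo]) = g z.
  by apply/cvg_lim => //; exact: cvg_nnsfun_approx.
have limx x : lim (\int[k x]_y (g_ n (x, y))%:E @[n --> \oo]) =
    \int[k x]_y g (x, y).
  rewrite -monotone_convergence//; last first.
    by move=> n y _; rewrite lee_fin.
  by apply: eq_integral => y _; rewrite lim_.
have mint n : measurable_fun setT (fun x => \int[k x]_y (g_ n (x, y))%:E).
  apply: (eq_measurable_fun (fun x =>
    \sum_(r \in range (g_ n)) r%:E * k x (xsection (g_ n @^-1` [set r]) x))).
    by move=> x _; rewrite sec.
  by apply: emeasurable_fsum => // r; apply: measurable_funeM; exact: mk.
transitivity (\int[m]_z lim ((g_ n z)%:E @[n --> \oo])).
  by apply: eq_integral => z _; rewrite lim_.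
rewrite monotone_convergence//; last by move=> n z _; rewrite lee_fin.
under eq_fun do rewrite integral_nnsfun.
rewrite -monotone_convergence//.
- by apply: eq_integral => x _; rewrite limx.
- by move=> n x _; apply: integral_ge0 => y _; rewrite lee_fin.
- move=> x _ a b ab; apply: ge0_le_integral => //.
  + by move=> y _; rewrite lee_fin.
  + by move=> y _; exact: nd_.
Qed.

End disintegration.

Section martingale_density.
Context {R : realType} {d : nat}.
Variables (mu nu : probability (Rd R d) R).
Hypothesis nu2 : P2 nu.
Local Notation U := (Rd R d).
Variable f : U * U -> R.
Hypothesis kf : coupling_density mu nu f.

Let mf : measurable_fun setT f. Proof. by case: kf. Qed.
Let f0 z : (0 <= f z)%R. Proof. by case: kf. Qed.
Let mfE : measurable_fun setT (EFin \o f). Proof. exact/measurable_EFinP. Qed.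

(** [k] is any disintegration of [m], not one built from [f]. Integrated over a measurable set [E],
    both sides give the integral of [1_E(x) g(y)] under [m], so they agree almost everywhere.
    Nonnegativity of [g] gives these integrals a meaning before integrability under [k x] is
    known. *)
Lemma disintegration_bary (m : probability (U * U)%type R) (k : R.-pker U ~> U)
    (g : U -> R) :
  has_density m (mu \x nu) f -> disintegrates m mu k ->
  measurable_fun setT g -> (forall y, 0 <= g y)%R ->
  nu.-integrable setT (EFin \o g) ->
  {ae mu, forall x, \int[k x]_y (g y)%:E = (bary nu g f x)%:E}.
Proof.
move=> df mk mg g0 ig.
have mgE : measurable_fun setT (EFin \o g) by exact/measurable_EFinP.
pose F x := \int[k x]_y (g y)%:E.
have F0 x : 0 <= F x by apply: integral_ge0 => y _; rewrite lee_fin.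
have mF : measurable_fun setT F.
  by apply: measurable_fun_integral_kernel => // V mV; exact: measurable_kernel.
pose G x := \int[nu]_y (g y * f (x, y))%:E.
have mgf : measurable_fun setT (fun z : U * U => (g z.2 * f z)%:E).
  by apply/measurable_EFinP; apply: measurable_funM => //; exact: measurableT_comp.
have gf0 (z : U * U) : 0 <= (g z.2 * f z)%:E by rewrite lee_fin mulr_ge0.
have mG : measurable_fun setT G by exact: (measurable_fun_fubini_tonelli_F _ mgf gf0).
have G0 x : 0 <= G x by apply: integral_ge0 => y _; exact: (gf0 (x, y)).
have iG : mu.-integrable setT G by exact: (integrable_fubini_F (integrable_snd kf ig)).
have : ae_eq mu setT G F.
  apply: integral_ae_eq => // E _ mE.
  have mind : measurable_fun setT (fun x : U => (\1_E x)%:E : \bar R).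
    by apply/measurable_EFinP; exact: measurable_indic.
  have ind0 (x : U) : 0 <= (\1_E x)%:E :> \bar R by rewrite lee_fin.
  pose H (z : U * U) := (\1_E z.1)%:E * (g z.2)%:E : \bar R.
  have mH : measurable_fun setT H.
    by apply: emeasurable_funM; [exact: (measurableT_comp mind)|exact: (measurableT_comp mgE)].
  have H0 z : 0 <= H z by rewrite mule_ge0 ?lee_fin.
  have -> : \int[mu]_(x in E) F x = \int[m]_z H z.
    rewrite (ge0_integral_disintegration mk)// integral_mkcond epatch_indic.
    apply: eq_integral => x _; rewrite /H /= ge0_integralZl//.
    - by rewrite muleC.
    - by move=> y _; rewrite lee_fin.
  rewrite (ge0_integral_density df)// fubini_tonelli1//; last 2 first.
  - exact: emeasurable_funM.
  - by move=> z; apply: mule_ge0 => //; rewrite lee_fin.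
  rewrite integral_mkcond epatch_indic; apply: eq_integral => x _.
  rewrite /fubini_F /H /= muleC -ge0_integralZl//.
  - by apply: eq_integral => y _; rewrite -!EFinM mulrA.
  - exact: (measurableT_comp mgf (pair1_measurable x)).
  - by move=> y _; exact: (gf0 (x, y)).
have := ae_integrable_bary kf ig; move=> h1 h2.
apply: filter_app h1; apply: filter_app h2; apply: aeW => x /(_ I) GF it.
by rewrite -(baryE it) -[LHS]/(F x) -GF.
Qed.

Lemma martingale_baryc (m : probability (U * U)%type R) :
  has_density m (mu \x nu) f -> MT mu nu m ->
  {ae mu, forall x, forall i, baryc nu f i x = coordv i x}.
Proof.
move=> df [_ [k mk kx']].
have kx : {ae mu, forall x : U, forall i,
  \int[k x]_y ((y : 'rV[R]_d) ord0 i)%:E = (coordv i x)%:E} by exact: kx'.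
(* Coordinates are signed, so [disintegration_bary] is applied to their positive and negative parts,
   whose integrals are almost surely finite and can be subtracted. *)
pose yp i (y : U) := Num.max (coordv i y) 0%R.
pose ym i (y : U) := Num.max (- coordv i y)%R 0%R.
have mc i : measurable_fun setT (@coordv R d i) by exact: measurable_coord.
have myp i : measurable_fun setT (yp i) by exact: measurable_maxr.
have mym i : measurable_fun setT (ym i).
  by apply: measurable_maxr => //; exact: measurable_funN.
have yp0 i y : (0 <= yp i y)%R by rewrite le_max lexx orbT.
have ym0 i y : (0 <= ym i y)%R by rewrite le_max lexx orbT.
have ic i : nu.-integrable setT (EFin \o coordv i).
  exact: sq_integrable_integrable (sq_integrable_coord nu2 i).
have iyp i : nu.-integrable setT (EFin \o yp i).
  by apply: le_integrable (ic i) => //; [exact/measurable_EFinP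
    |move=> y _; rewrite lee_fin ger0_norm// ge_max ler_norm normr_ge0].
have iym i : nu.-integrable setT (EFin \o ym i).
  by apply: le_integrable (ic i) => //; [exact/measurable_EFinP
    |move=> y _; rewrite lee_fin ger0_norm// ge_max -normrN ler_norm normr_ge0].
have yE i y : coordv i y = (yp i y - ym i y)%R.
  rewrite /yp /ym; case: (leP (coordv i y) 0%R) => h;
  case: (leP (- coordv i y)%R 0%R) => h'; lra.
apply: filter_forall => i.
have hp := disintegration_bary df mk (myp i) (yp0 i) (iyp i).
have hm := disintegration_bary df mk (mym i) (ym0 i) (iym i).
have ap := ae_integrable_bary kf (iyp i).
have am := ae_integrable_bary kf (iym i).
have ac := ae_integrable_bary kf (ic i).
apply: filter_app hp; apply: filter_app hm; apply: filter_app ap.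
apply: filter_app am; apply: filter_app ac; apply: filter_app kx; apply: aeW.
move=> x /(_ i) kx ac am ap hm hp; apply: EFin_inj.
rewrite -[RHS]kx integralE.
have -> : \int[k x]_y (fun y : U => ((y : 'rV[R]_d) ord0 i)%:E)^\+ y =
    \int[k x]_y (yp i y)%:E.
  by apply: eq_integral => y _; rewrite funeposE -EFin_max.
have -> : \int[k x]_y (fun y : U => ((y : 'rV[R]_d) ord0 i)%:E)^\- y =
    \int[k x]_y (ym i y)%:E.
  by apply: eq_integral => y _; rewrite funenegE -EFinN -EFin_max.
rewrite hp hm -(baryE ap) -(baryE am) -integralB// /baryc -(baryE ac).
by apply: eq_integral => y _; rewrite yE mulrBl EFinB.
Qed.

(** The measure with density [f] disintegrates along its slices, whose barycenters are those of
    [f]. *)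
Lemma MT_exists :
  {ae mu, forall x, forall i, baryc nu f i x = coordv i x} ->
  exists2 m, MT mu nu m & has_density m (mu \x nu) f.
Proof.
move=> bf.
have [m df] := has_density_exists mf f0 (coupling_density_int1 kf).
exists m => //; split; first by apply/(coupling_density_marginals df).
have fE0 z : 0 <= (EFin \o f) z by rewrite lee_fin.
pose F x := \int[nu]_y (f (x, y))%:E.
have mF : measurable_fun setT F by exact: (measurable_fun_fubini_tonelli_F _ mfE fE0).
(* A probability kernel needs mass one at every [x]; the null set of bad slices receives the density
   [1], that is [nu] itself. *)
pose g x y := if F x == 1 then f (x, y) else 1%R.
have mg : measurable_fun setT (fun z : U * U => g z.1 z.2).
  apply: measurable_fun_ifT => //.
    apply: (measurable_fun_bool true); rewrite setTI.
    rewrite [X in measurable X](_ : _ = (F \o fst) @^-1` [set 1]); last first.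
      by apply/seteqP; split => z /= /eqP.
    rewrite -[X in measurable X]setTI.
    by apply: (measurableT_comp mF) => //; exact: emeasurable_set1.
  by under eq_fun do rewrite -surjective_pairing.
have g0 x y : (0 <= g x y)%R by rewrite /g; case: ifP.
have mgx x : measurable_fun setT (g x).
  exact: (measurableT_comp mg (pair1_measurable x)).
have g1 x : \int[nu]_y (g x y)%:E = 1.
  by rewrite /g; case: eqP => [//|_]; exact: (integral_prob_cst nu 1).
have /choice[kk dk] : forall x, exists Q : probability U R, has_density Q nu (g x).
  by move=> x; exact: has_density_exists.
pose kf' (x : U) : {measure set U -> \bar R} := kk x.
have mkk V : measurable V -> measurable_fun setT (kf' ^~ V).
  move=> mV; have E : kf' ^~ V = fubini_F nu (fun z => (g z.1 z.2)%:E * (\1_V z.2)%:E).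
    apply/funext => x; have [_ _ kE] := dk x; apply: (etrans (kE V mV)).
    by rewrite integral_mkcond epatch_indic.
  rewrite E; apply: measurable_fun_fubini_tonelli_F; last first.
    by move=> z; rewrite mule_ge0// lee_fin.
  apply: emeasurable_funM; first exact/measurable_EFinP.
  apply/measurable_EFinP; apply: measurableT_comp => //; exact: measurable_indic.
have kk1 x : kf' x setT = 1 by exact: probability_setT.
pose k0 : R.-ker U ~> U := HB.pack kf' (isKernel.Build _ _ _ _ _ kf' mkk).
pose k : R.-pker U ~> U := HB.pack kf' k0
  (Kernel_isProbability.Build _ _ _ _ _ k0 kk1).
have [_ _ f1 _] := kf.
exists k.
- move=> C mC; rewrite (has_density_setX df)//.
  have mind : measurable_fun setT (fun z : U * U => (\1_C z)%:E : \bar R).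
    by apply/measurable_EFinP; exact: measurable_indic.
  rewrite fubini_tonelli1//; last 2 first.
  + exact: emeasurable_funM.
  + by move=> z; rewrite mule_ge0 ?lee_fin.
  apply: ge0_ae_eq_integral => //.
  + apply: measurable_fun_fubini_tonelli_F; first exact: emeasurable_funM.
    by move=> z; rewrite mule_ge0 ?lee_fin.
  + by apply: measurable_fun_xsection_finite_kernel; rewrite inE.
  + by move=> x _; apply: integral_ge0 => y _; rewrite mule_ge0 ?lee_fin.
  apply: filter_app f1; apply: aeW => x fx _; have [_ _ kE] := dk x.
  apply/esym; apply: (etrans (kE _ (measurable_xsection x mC))).
  rewrite integral_mkcond epatch_indic; apply: eq_integral => y _ /=.
  by rewrite /g /F fx eqxx muleC !indicE mem_xsection.
apply: filter_app f1; apply: filter_app bf.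
have ic i : nu.-integrable setT (EFin \o coordv i).
  exact: sq_integrable_integrable (sq_integrable_coord nu2 i).
have : {ae mu, forall x, forall i,
    nu.-integrable setT (fun y => (coordv i y * f (x, y))%:E)}.
  by apply: filter_forall => i; exact: (ae_integrable_bary kf (ic i)).
apply: filter_app; apply: aeW => x it bx fx i; rewrite /= /kf'.
rewrite (integral_density (dk x) (@measurable_coord _ _ i)).
rewrite -[RHS]/((coordv i x)%:E) -bx -[RHS](baryE (it i)).
by apply: eq_integral => y _; rewrite /g /F fx eqxx.
Qed.

End martingale_density.

(** * Weak and strong duality *)

Section product_image.
Context {d1 d2 d3} {S : measurableType d1} {T : measurableType d2}
  {U : measurableType d3} {R : realType}.
Variables (rho : probability S R) (P : probability T R) (N : probability U R).
Variable p : S -> T.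
Hypothesis im : is_image rho p P.

Let mp : measurable_fun setT p. Proof. by case: im. Qed.

Let mphi : measurable_fun setT (fun z : S * U => (p z.1, z.2)).
Proof. by apply: measurable_fun_pair => //; exact: measurableT_comp. Qed.

Lemma is_image_product :
  is_image (rho \x N) (fun z : S * U => (p z.1, z.2)) (P \x N).
Proof.
split=> // C mC.
transitivity (\int[P]_x N (xsection C x)); first by [].
by rewrite (ge0_integral_image im)//; exact: measurable_fun_xsection.
Qed.

(** Used with [p] a projection, to lift the density of a martingale coupling to the glued measure,
    and with [p] the dual variable, to bring couplings of its law back to [mu]. *)
Lemma coupling_density_pullback (f : T * U -> R) : coupling_density P N f ->
  coupling_density rho N (fun z => f (p z.1, z.2)).
Proof.
move=> [mf f0 f1 f2]; split => //.
- exact: (measurableT_comp mf mphi).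
- exact: (ae_image im f1).
- apply: filter_app f2; apply: aeW => u <-.
  rewrite (ge0_integral_image im)//; last by move=> t; rewrite lee_fin.
  apply/measurable_EFinP; exact: (measurableT_comp mf (pair2_measurable u)).
Qed.

End product_image.

Section dot_pairing.
Context {disp} {T : measurableType disp} {R : realType} {d : nat}.
Variables (P : probability T R) (nu : probability (Rd R d) R).
Hypothesis nu2 : P2 nu.
Variables (f : T * Rd R d -> R) (a : 'I_d -> T -> R).
Hypothesis kf : coupling_density P nu f.
Hypothesis sqa : forall i, sq_integrable P (a i).

Lemma integral_dot_pairing :
  \int[P \x nu]_z ((\sum_i a i z.1 * coordv i z.2) * f z)%:E =
  \int[P]_t (\sum_i a i t * baryc nu f i t)%:E.
Proof.
have E z : ((\sum_i a i z.1 * coordv i z.2) * f z)%:E =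
    \sum_i (a i z.1 * coordv i z.2 * f z)%:E by rewrite mulr_suml sumEFin.
under eq_integral do rewrite E.
rewrite integral_sum//; last first.
  by move=> i; exact: (integrable_pairing kf (sqa i) (sq_integrable_coord nu2 i)).
under [RHS]eq_integral do rewrite -sumEFin.
rewrite integral_sum//; last first.
  move=> i; apply: sq_integrableM => //.
  exact: (sq_integrable_bary kf (sq_integrable_coord nu2 i)).
apply: eq_bigr => i _.
exact: (integral_pairing kf (sqa i) (sq_integrable_coord nu2 i)).
Qed.

End dot_pairing.

Section couplings.
Context {R : realType} {d : nat}.
Local Notation U := (Rd R d).
Implicit Types mu nu mub : probability U R.

Lemma CplP mub mu pi :
  Cpl mub mu pi <-> is_image pi fst mub /\ is_image pi snd mu.
Proof.
split=> [[h1 h2]|[[_ h1] [_ h2]]]; last by split=> A mA; [rewrite h1|rewrite h2].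
by split; split=> // A mA; [rewrite h1|rewrite h2].
Qed.

Lemma measurable_dotv_pair :
  measurable_fun [set: U * U] (fun z => dotv z.1 z.2).
Proof. exact: measurable_dotv. Qed.

Lemma integrable_dotv_Cpl mub mu pi : P2 mub -> P2 mu -> Cpl mub mu pi ->
  pi.-integrable setT (fun z => (dotv z.1 z.2)%:E).
Proof.
move=> b2 m2 /CplP[i1 i2].
have mdd : measurable_fun [set: U] (fun y => dotv y y) by exact: measurable_dotv.
have h1 := (integrable_image i1 mdd).1 (integrable_dotv b2).
have h2 := (integrable_image i2 mdd).1 (integrable_dotv m2).
apply: (le_integrable measurableT _ _ (integrableD measurableT h1 h2)).
  by apply/measurable_EFinP; exact: measurable_dotv_pair.
move=> z _; rewrite /= lee_fin.
by apply: (le_trans (normr_dotv_le _ _)); exact: ler_norm.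
Qed.

(* Gluing [rho] with [m] along their common marginal [mu] and forgetting the
   middle point does not increase entropy; the martingale property turns the
   cost [xbar . y] into [xbar . x]. *)
Lemma glued_coupling mu nu mub rho m : P2 nu -> P2 mub -> P2 mu ->
  MT mu nu m -> Cpl mub mu rho -> rel_entropy m (mu \x nu) < +oo ->
  exists2 pi, Cpl mub nu pi &
    rel_entropy pi (mub \x nu) <= rel_entropy m (mu \x nu) /\
    \int[pi]_z (dotv z.1 z.2)%:E = \int[rho]_z (dotv z.1 z.2)%:E.
Proof.
move=> n2 b2 m2 mtm cr Hm.
have [f df] : exists f, has_density m (mu \x nu) f.
  apply: dominates_density; move: Hm; rewrite /rel_entropy.
  by case: asboolP => // _; rewrite ltxx.
have /CplP[r1 r2] := cr.
have kf : coupling_density mu nu f.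
  by apply/(coupling_density_marginals df); case: mtm.
have bf := martingale_baryc n2 kf df mtm.
(* The gluing in which, given [x], the point [y] is independent of [xbar]: its density relative to
   [rho \x nu] depends on [x] and [y] alone. *)
pose F (z : (U * U) * U) := f (z.1.2, z.2).
have kF : coupling_density rho nu F by exact: (coupling_density_pullback r2 kf).
have [mF F0 _ _] := kF.
have [G dG] := has_density_exists mF F0 (coupling_density_int1 kF).
have [G1 G2] := (coupling_density_marginals dG).1 kF.
pose phi (z : (U * U) * U) := (z.1.1, z.2).
have imP := is_image_product nu r1; have imM := is_image_product nu r2.
have [mphi _] := imP.
have [pi ipi] := is_image_exists G mphi.
have [_ piE] := ipi.
have pidom : pi `<< mub \x nu.
  apply/dominatesP => A mA A0; rewrite piE//.
  apply: ((dominatesP _ _).1 (has_density_dominates dG)).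
    by rewrite -[X in measurable X]setTI; exact: mphi.
  by rewrite -A0; case: imP => _ ->.
have [h dh] := dominates_density pidom.
exists pi; first split=> A mA.
- rewrite piE; last by rewrite -[X in measurable X]setTI; exact: measurable_fst.
  have [mfst rA] := r1; rewrite rA// -G1//.
  by rewrite -[X in measurable X]setTI; exact: mfst.
- rewrite piE; last by rewrite -[X in measurable X]setTI; exact: measurable_snd.
  by rewrite -G2.
have mdd := measurable_dotv_pair.
split.
  (* [phi] carries [rho \x nu] to [mub \x nu] and [G] to [pi]. The entropy of [F] equals that of
     [f], since the second marginal of [rho] is [mu]. *)
  rewrite (rel_entropyE dh) (rel_entropyE df).
  apply: (le_trans (data_processing imP ipi dG dh)).
  rewrite (ge0_integral_image imM)//.
  - by apply/measurable_EFinP; apply: (measurableT_comp measurable_kl); case: df.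
  - by move=> z; rewrite lee_fin kl_ge0//; case: df.
rewrite (integral_image ipi mdd)//.
rewrite (integral_density dG (measurableT_comp mdd mphi)).
pose a i (z : U * U) := coordv i z.1.
have sqa i : sq_integrable rho (a i).
  apply/(sq_integrable_image r1); first exact: measurable_coord.
  exact: sq_integrable_coord.
(* Integrating in [y] replaces [y] by its barycenter given [x], which is [x] for [rho]-almost every
   pair. *)
rewrite -[LHS]/(\int[rho \x nu]_z ((\sum_i a i z.1 * coordv i z.2) * F z)%:E).
rewrite (integral_dot_pairing n2 kF sqa).
apply: ae_eq_integral => //.
- apply/measurable_EFinP; apply: measurable_sum => i; apply: measurable_funM.
    by case: (sqa i).
  exact: (measurable_baryc n2 i kF).
- exact/measurable_EFinP.
have := ae_image r2 bf; apply: filter_app; apply: aeW => z bz _.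
by congr (_%:E); apply: eq_bigr => i _; congr (_ * _)%R; exact: bz.
Qed.

(* The law of a dual variable [r] is feasible in the outer supremum: a coupling
   of that law with [nu] has a density on [mub x nu], which pulls back to a
   density on [mu x nu]. *)
Lemma dual_variable_law mu nu (r : 'I_d -> U -> R) (v : R) :
  P2 mu -> P2 nu -> (forall i, sq_integrable mu (r i)) ->
  (forall f, coupling_density mu nu f ->
    v%:E <= \int[mu \x nu]_z (kl (f z))%:E -
            \int[mu]_t (\sum_i r i t * baryc nu f i t)%:E +
            \int[mu]_t (\sum_i r i t * coordv i t)%:E) ->
  exists2 mub, P2 mub &
    v%:E <= ereal_inf [set rel_entropy pi (mub \x nu) -
                           \int[pi]_z (dotv z.1 z.2)%:E | pi in Cpl mub nu] +
            MCov mub mu.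
Proof.
move=> m2 n2 sqr vr.
pose X (x : U) : U := \row_i r i x.
have mX : measurable_fun setT X.
  by apply: measurable_rV => i; under eq_fun do rewrite mxE; case: (sqr i).
have [mub imX] := is_image_exists mu mX.
have sqb i : sq_integrable mub (coordv i).
  apply/(sq_integrable_image imX); first exact: measurable_coord.
  by rewrite (_ : (fun s => _) = r i)//; apply/funext => s; rewrite /coordv mxE.
have b2 : P2 mub.
  rewrite /P2/=; under eq_integral do rewrite /dotv -sumEFin.
  rewrite integral_sum//; last by move=> i; exact: (sq_integrableM (sqb i) (sqb i)).
  apply: lte_sum_pinfty => i _.
  by apply: integrable_lty => //; exact: (sq_integrableM (sqb i) (sqb i)).
exists mub => //.
(* The joint law of [X] and the identity: its cost is a lower bound for [MCov]. *)
have [rho irho] := is_image_exists mu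
  (measurable_fun_pair mX (@measurable_id _ U setT)).
have crho : Cpl mub mu rho.
  have [_ rE] := irho; have [_ bE] := imX; split=> A mA; rewrite rE.
  - by rewrite bE.
  - by rewrite -[X in measurable X]setTI; exact: measurable_fst.
  - by [].
  - by rewrite -[X in measurable X]setTI; exact: measurable_snd.
have mdd := measurable_dotv_pair.
have rdot : \int[rho]_z (dotv z.1 z.2)%:E =
    \int[mu]_t (\sum_i r i t * coordv i t)%:E.
  rewrite (integral_image irho mdd); apply: eq_integral => t _.
  by congr (_%:E); apply: eq_bigr => i _; rewrite mxE.
have rfin : \int[rho]_z (dotv z.1 z.2)%:E \is a fin_num.
  by apply: integrable_fin_num => //; exact: integrable_dotv_Cpl crho.
rewrite -(subeK v%:E rfin); apply: leeD; last first.
  by apply: ereal_sup_ubound; exists rho.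
apply: le_ereal_inf_tmp => _ [pi cpi <-].
have pfin : \int[pi]_z (dotv z.1 z.2)%:E \is a fin_num.
  by apply: integrable_fin_num => //; exact: integrable_dotv_Cpl cpi.
have [Hpi|] := ltP (rel_entropy pi (mub \x nu)) +oo; last first.
  by rewrite leye_eq => /eqP ->; rewrite -(fineK pfin) leey.
have [h dh] : exists h, has_density pi (mub \x nu) h.
  apply: dominates_density; move: Hpi; rewrite /rel_entropy.
  by case: asboolP => // _; rewrite ltxx.
have kh : coupling_density mub nu h by exact/(coupling_density_marginals dh).
pose f (z : U * U) := h (X z.1, z.2).
have kf : coupling_density mu nu f by exact: (coupling_density_pullback imX kh).
have [mh h0 _] := dh.
have imP := is_image_product nu imX.
(* For the pulled-back density, the entropy and the pairing in [vr] are exactly the entropy and the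
   cost of [pi]. *)
rewrite leeBlDr//; apply: (le_trans (vr f kf)).
rewrite -rdot leeD2r// (rel_entropyE dh) (ge0_integral_image imP)//; last 2 first.
- by apply/measurable_EFinP; exact: measurableT_comp measurable_kl mh.
- by move=> z; rewrite lee_fin kl_ge0.
rewrite (integral_density dh mdd) (integral_image imP); last exact: measurable_funM.
rewrite -(integral_dot_pairing n2 kf sqr).
rewrite leeD2l// leeN2 le_eqVlt; apply/orP; left; apply/eqP.
apply: eq_integral => z _; congr (_ * _)%:E.
by apply: eq_bigr => i _; rewrite mxE.
Qed.

End couplings.

Section attainment.
Context {R : realType} {d : nat}.
Local Notation U := (Rd R d).
Variables (mu nu : probability U R).
Hypotheses (mu2 : P2 mu) (nu2 : P2 nu).

Let sqx := sq_integrable_coord mu2.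

(* The penalties [n * |x - B f|^2] force the barycenter constraint in the limit. *)
Lemma martingale_coupling_le (b : R) :
  (forall n : nat, exists2 f, coupling_density mu nu f &
    \int[mu \x nu]_z (kl (f z))%:E +
      n%:R%:E * penalty mu nu (@coordv R d) f <= b%:E) ->
  exists2 m, MT mu nu m & rel_entropy m (mu \x nu) <= b%:E.
Proof.
move=> Jb.
have [|||||f kf Jf] := @penalized_entropy_limit _ _ _ _ _ mu nu (@weight R d)
    (@weight_ge1 R d) (sq_integrable_weight nu2)
    (fun n f => n%:R%:E * penalty mu nu (@coordv R d) f) b.
- by move=> n f; rewrite mule_ge0 ?lee_fin ?penalty_ge0.
- by move=> n m f nm; rewrite lee_wpmul2r ?penalty_ge0// lee_fin ler_nat.
- move=> n f g kf kg; rewrite muleCA -ge0_muleDr ?penalty_ge0//.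
  by rewrite lee_wpmul2l ?lee_fin// penalty_mid.
- move=> n f_ f kf_ kf lf; have h := penalty_lsc nu2 sqx kf_ kf lf.
  by apply: le_trans (limn_einfZl _ (ler0n R n)); rewrite lee_wpmul2l ?lee_fin.
- move=> n e e0; have [f kf Jf] := Jb n; exists f => //.
  by apply: (le_trans Jf); rewrite lee_fin lerDl ltW.
have [mf f0 _ _] := kf.
have ent0 : 0 <= \int[mu \x nu]_z (kl (f z))%:E.
  by apply: integral_ge0 => z _; rewrite lee_fin kl_ge0.
have pen0 := penalty_ge0 mu nu (@coordv R d) f.
have pen_le n : n%:R%:E * penalty mu nu (@coordv R d) f <= b%:E.
  by apply: le_trans (Jf n); rewrite leeDr.
have penfin : penalty mu nu (@coordv R d) f \is a fin_num.
  by rewrite ge0_fin_numE// (le_lt_trans _ (ltry b))// -[leLHS]mul1e; exact: (pen_le 1%N).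
(* A positive penalty [p] would make [n p] exceed [b] as soon as [n > b / p]. *)
have penE : penalty mu nu (@coordv R d) f = 0.
  move: pen0 pen_le; rewrite -(fineK penfin); set p := fine _.
  rewrite lee_fin le_eqVlt => /predU1P[<-//|p0 pb]; exfalso.
  have := pb (Num.truncn (b / p)).+1; rewrite -EFinM lee_fin leNgt => /negP; apply.
  by rewrite -ltr_pdivrMr// truncnS_gt.
have bf : {ae mu, forall x, forall i, baryc nu f i x = coordv i x}.
  have mp := measurable_penalty nu2 sqx kf.
  have /(ae_eq_integral_abs mu measurableT) : measurable_fun setT
    (fun t => (\sum_i (coordv i t - baryc nu f i t) ^+ 2)%:E) by exact/measurable_EFinP.
  move=> [+ _]; have -> : \int[mu]_t `|(\sum_i (coordv i t - baryc nu f i t) ^+ 2)%:E| = 0.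
    rewrite -[RHS]penE; apply: eq_integral => t _; rewrite gee0_abs// lee_fin.
    by apply: sumr_ge0 => i _; exact: sqr_ge0.
  move=> /(_ erefl); apply: filter_app; apply: aeW => x /(_ I) [] /eqP.
  rewrite psumr_eq0 => [/allP h i|i _]; last exact: sqr_ge0.
  by have := h i (mem_index_enum i); rewrite sqrf_eq0 subr_eq0 => /eqP.
have [m mtm dm] := MT_exists nu2 kf bf.
exists m => //; rewrite (rel_entropyE dm).
by have := Jf 0%N; rewrite mul0e adde0.
Qed.

End attainment.

(** The infimum in the role of [a] may be infinite. If [a = +oo], the finite bound forces every
    [c t] to be [-oo], and the convention that [+oo] plus [-oo] is [-oo] settles the case. *)
Lemma adde_ereal_sup_le (R : realType) (T : Type) (S : set T) (c : T -> \bar R)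
    (a b : \bar R) :
  b \is a fin_num -> (forall t, S t -> a + c t <= b) -> a + ereal_sup (c @` S) <= b.
Proof.
move=> bfin acb; case: a acb => [a| |] acb; last by rewrite addNye leNye.
  rewrite -leeBrDl//; apply: ge_ereal_sup => _ [t St <-].
  by rewrite leeBrDl// acb.
have -> : ereal_sup (c @` S) = -oo; last by rewrite addeNy leNye.
apply/eqP; rewrite -leeNy_eq; apply: ge_ereal_sup => _ [t St <-].
by have := acb t St; rewrite -(fineK bfin); case: (c t).
Qed.

Theorem lemma2p2 (R : realType) (d : nat) (mu nu : probability (Rd R d) R)
    (mu_P2 : P2 mu) (nu_P2 : P2 nu) (mu_le_nu : convex_order mu nu) :
  ereal_inf [set rel_entropy m (mu \x nu) | m in MT mu nu] =
  ereal_sup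
    [set ereal_inf
           [set rel_entropy pi (mub \x nu) - \int[pi]_z (dotv z.1 z.2)%:E
              | pi in Cpl mub nu]
         + MCov mub mu
       | mub in @P2 R d].
Proof.
apply/eqP; rewrite eq_le; apply/andP; split; last first.
  apply: ge_ereal_sup => _ [mub mub2 <-]; apply: le_ereal_inf_tmp => _ [m mtm <-].
  have [Hm|] := ltP (rel_entropy m (mu \x nu)) +oo; last first.
    by rewrite leye_eq => /eqP ->; exact: leey.
  have Hfin : rel_entropy m (mu \x nu) \is a fin_num.
    by rewrite ge0_fin_numE// rel_entropy_ge0.
  apply: adde_ereal_sup_le => // rho crho.
  have [pi cpi [Hpi piE]] := glued_coupling nu_P2 mub2 mu_P2 mtm crho Hm.
  have rfin : \int[rho]_z (dotv z.1 z.2)%:E \is a fin_num.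
    by apply: integrable_fin_num => //; exact: integrable_dotv_Cpl crho.
  rewrite -leeBrDr//; apply: (@le_trans _ _
    (rel_entropy pi (mub \x nu) - \int[pi]_z (dotv z.1 z.2)%:E)).
    by apply: ereal_inf_lbound; exists pi.
  by rewrite piE leeD2r.
(* Whatever the strength [n], the penalized minimum is bounded by a real number below [b]; this
   uniformity is what the limit requires. *)
set b := ereal_sup _.
have key (n : nat) : exists f (v : R), [/\ coupling_density mu nu f,
    \int[mu \x nu]_z (kl (f z))%:E +
      n%:R%:E * penalty mu nu (@coordv R d) f <= v%:E & v%:E <= b].
  have [r [v [sqr [f kf Jf] vr]]] :=
    penalized_dual nu_P2 (sq_integrable_coord mu_P2) (ler0n R n).
  exists f, v; split => //.
  have [mub mub2 vb] := dual_variable_law mu_P2 nu_P2 sqr vr.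
  by apply: (le_trans vb); apply: ereal_sup_ubound; exists mub.
have [boo|] := ltP b +oo; last by rewrite leye_eq => /eqP ->; exact: leey.
have bfin : b \is a fin_num.
  rewrite fin_numE (lt_eqF boo) andbT; apply/eqP => bNy.
  by have [_ [v [_ _]]] := key 0%N; rewrite bNy leeNy_eq.
have [|m mtm Hm] := martingale_coupling_le mu_P2 nu_P2 (b := fine b).
  by move=> n; have [f [v [kf Jf vb]]] := key n; exists f => //;
    rewrite fineK// (le_trans Jf).
by rewrite -(fineK bfin); apply: le_trans Hm; apply: ereal_inf_lbound; exists m.
Qed.
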